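(* Let $d\in\mathbb N$ and $p\in[1,\infty]$. Let $u,v>0$ with $\frac1u+\frac1v=1$. Then for any $\varphi,\psi\in L^p(\mathbb R^d,\mu)$, $\Gamma(1/\sqrt u)\varphi\diamond\Gamma(1/\sqrt v)\psi\in L^p(\mathbb R^d,\mu)$ and $$\Big\|\Gamma\big(\tfrac1{\sqrt u}\big)\varphi\diamond\Gamma\big(\tfrac1{\sqrt v}\big)\psi\Big\|_p\le\|\varphi\|_p\,\|\psi\|_p.$$
   Context: $\mu$ is the standard Gaussian probability measure on $\mathbb R^d$ and $\|\cdot\|_p$ is the norm of $L^p(\mathbb R^d,\mu)$. Gaussian chaos setting: $L^2(\mathbb R^d,\mu)=\bigoplus_{n\ge0}G_n$, $G_0=\mathbb C$, $G_n=\overline{F_n}\ominus\overline{F_{n-1}}$ with $F_n$ the polynomials of degree $\le n$ in the coordinates; $P_n$ the orthogonal projection onto $G_n$. Wick product: $\varphi\diamond\psi=P_{m+n}(\varphi\psi)$ for $\varphi\in G_m,\psi\in G_n$, extended bilinearly ($\varphi\diamond\psi=\sum_k\sum_{i+j=k}f_i\diamond g_j$ for $\varphi=\sum f_n$, $\psi=\sum g_n$). Second quantization: $\Gamma(c)\sum f_n=\sum c^nf_n$; for real $|c|\le1$ it extends to a norm-one operator on each $L^p(\mu)$, $1\le p\le\infty$. For $1/u+1/v=1$ the bilinear map $(\varphi,\psi)\mapsto\Gamma(1/\sqrt u)\varphi\diamond\Gamma(1/\sqrt v)\psi$, bounded on $L^2\times L^2\to L^2$, extends uniquely continuously to $L^1\times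 L^1\to L^1$, and this extension is what the expression means for general $L^p$ arguments. *)

(* Defs.v *)
From HB Require Import structures.
From mathcomp Require Import all_boot all_order all_algebra.
From mathcomp Require Import all_classical all_reals all_analysis.
From mathcomp.real_closed Require Import complex.
Set Implicit Arguments. Unset Strict Implicit. Unset Printing Implicit Defensive.
Import Order.TTheory GRing.Theory Num.Theory.
Import numFieldNormedType.Exports.
Local Open Scope classical_set_scope.
Local Open Scope ring_scope.

(* R^d is represented by d-tuples of reals, with the product Borel sigma-algebra
   (the sigma-algebra generated by the coordinate projections). We use the copy
   [measurableTypeR R] of R carrying the Borel sets, on which [normal_prob] lives. *)
Notation Rdim R d := (d.-tuple (measurableTypeR R)).

Section GaussianChaos.
Variable R : realType.
Local Notation RR := (measurableTypeR R).
Local Notation C := R[i].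

Definition tcons (n : nat) (x : RR * n.-tuple RR) : n.+1.-tuple RR :=
  [tuple of x.1 :: x.2].

Lemma measurable_tcons n : measurable_fun [set: RR * n.-tuple RR] (@tcons n).
Proof. by apply: measurable_cons; [exact: measurable_fst | exact: measurable_snd]. Qed.

HB.instance Definition _ n :=
  isMeasurableFun.Build _ _ _ _ (@tcons n) (@measurable_tcons n).

Fixpoint gauss_measure (d : nat) : probability (d.-tuple RR) R :=
  match d with
  | 0 => [the probability _ _ of dirac [tuple]]
  | d'.+1 =>
      [the probability _ _ of distribution (normal_prob 0 1 \x gauss_measure d')%E (@tcons d')]
  end.

Definition cabs (z : C) : R := Num.sqrt (complex.Re z ^+ 2 + complex.Im z ^+ 2).

Definition cmeasurable d (f : Rdim R d -> C) :=
  measurable_fun [set: Rdim R d] (fun x => complex.Re (f x)) /\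
  measurable_fun [set: Rdim R d] (fun x => complex.Im (f x)).

Definition Lpnorm d (p : \bar R) (f : Rdim R d -> C) : \bar R :=
  Lnorm (gauss_measure d) p (fun x => (cabs (f x))%:E).

Definition inLp d (p : \bar R) (f : Rdim R d -> C) :=
  cmeasurable f /\ (Lpnorm p f < +oo)%E.

Definition Lp_cvg d (p : \bar R) (fk : nat -> Rdim R d -> C) (f : Rdim R d -> C) :=
  (fun k => Lpnorm p (fun x => fk k x - f x)) @ \oo --> 0%E.

Definition cinner d (f g : Rdim R d -> C) : C :=
  Complex (Rintegral (gauss_measure d) [set: Rdim R d] (fun x => complex.Re (f x * (g x)^*%C)))
          (Rintegral (gauss_measure d) [set: Rdim R d] (fun x => complex.Im (f x * (g x)^*%C))).

Definition monomial d (a : 'I_d -> nat) (x : Rdim R d) : C :=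
  \prod_(i < d) ((tnth x i : R)%:C)%C ^+ a i.

Definition polyF d (n : nat) : set (Rdim R d -> C) :=
  [set f | exists c : {ffun 'I_d -> 'I_n.+1} -> C,
     f = fun x => \sum_(a : {ffun 'I_d -> 'I_n.+1} | (\sum_(i < d) (a i : nat) <= n)%N)
                    c a * monomial (fun i => (a i : nat)) x].
Arguments polyF : clear implicits.

Definition L2closure d (S : set (Rdim R d -> C)) : set (Rdim R d -> C) :=
  [set g | inLp 2%:E g /\
     forall e : R, 0 < e -> exists f, S f /\ (Lpnorm 2%:E (fun x => (g x - f x)%R) < e%:E)%E].
Arguments L2closure : clear implicits.

Definition chaos d (n : nat) : set (Rdim R d -> C) :=
  match n with
  | 0 => L2closure d (polyF d 0)
  | n'.+1 => [set g | L2closure d (polyF d n) g /\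
                forall h, L2closure d (polyF d n') h -> cinner g h = 0]
  end.
Arguments chaos : clear implicits.

Definition is_proj d (n : nat) (phi g : Rdim R d -> C) :=
  chaos d n g /\ forall h, chaos d n h -> cinner (fun x => phi x - g x) h = 0.

Definition is_chaos_dec d (phi : Rdim R d -> C) (f : nat -> Rdim R d -> C) :=
  forall n, is_proj n phi (f n).

Definition is_Gamma d (c : R) (phi g : Rdim R d -> C) :=
  inLp 2%:E phi /\ inLp 2%:E g /\
  exists f, is_chaos_dec phi f /\
    Lp_cvg 2%:E (fun N x => \sum_(n < N) (c%:C)%C ^+ n * f n x) g.

Definition is_wick d (phi psi w : Rdim R d -> C) :=
  inLp 2%:E phi /\ inLp 2%:E psi /\ inLp 2%:E w /\
  exists (f g : nat -> Rdim R d -> C) (h : nat -> nat -> Rdim R d -> C),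
    [/\ is_chaos_dec phi f, is_chaos_dec psi g,
        (forall i j, is_proj (i + j) (fun x => f i x * g j x) (h i j)) &
        Lp_cvg 2%:E (fun N x => \sum_(k < N) \sum_(i < k.+1) h i (k - i)%N x) w].

Definition wickGamma_L2 d (u v : R) (phi psi w : Rdim R d -> C) :=
  exists phi' psi', [/\ is_Gamma (Num.sqrt u)^-1 phi phi',
                        is_Gamma (Num.sqrt v)^-1 psi psi' & is_wick phi' psi' w].

(* w = Gamma(1/sqrt u) phi <> Gamma(1/sqrt v) psi for phi, psi in L^1, in the sense
   of the unique continuous extension L^1 x L^1 -> L^1 of the L^2 bilinear map :
   w is the L^1-limit of the L^2 values along every pair of L^2 sequences
   converging in L^1 to (phi, psi). *)
Definition wickGamma d (u v : R) (phi psi w : Rdim R d -> C) :=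
  [/\ inLp 1%:E phi, inLp 1%:E psi, inLp 1%:E w &
    forall (phik psik wk : nat -> Rdim R d -> C),
      (forall k, [/\ inLp 2%:E (phik k), inLp 2%:E (psik k) &
                     wickGamma_L2 u v (phik k) (psik k) (wk k)]) ->
      Lp_cvg 1%:E phik phi -> Lp_cvg 1%:E psik psi -> Lp_cvg 1%:E wk w].

End GaussianChaos.

(* Main.v *)
Require Import Defs.
From HB Require Import structures.
From mathcomp Require Import all_boot all_order all_algebra.
From mathcomp Require Import all_classical all_reals all_analysis.
From mathcomp Require Import measurable_realfun ess_sup_inf.
From mathcomp.real_closed Require Import complex.
From mathcomp Require Import ring lra.
Set Implicit Arguments. Unset Strict Implicit. Unset Printing Implicit Defensive.
Import Order.TTheory GRing.Theory Num.Theory.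
Import numFieldNormedType.Exports.
Local Open Scope classical_set_scope.
Local Open Scope ring_scope.

(* With c = 1/sqrt u and s = 1/sqrt v one has c^2 + s^2 = 1 and
     (Gamma(c) phi <> Gamma(s) psi)(x) = int phi(c x + s y) psi(s x - c y) dmu(y).
   The reflection (x, y) |-> (c x + s y, s x - c y) preserves mu (x) mu, so the bound
   for the right-hand side is Jensen's inequality in y followed by Tonelli, and the
   same computation for p = 1 makes the right-hand side continuous on L^1 x L^1.

   The identity itself is only needed for polynomials. If phi and psi are polynomials
   of degree m and n orthogonal to all lower degrees, then the right-hand side is
   c^m s^n phi psi up to degree < m + n, and undoing the reflection shows that it is
   orthogonal to every polynomial of degree < m + n; hence it is
   c^m s^n P_(m+n)(phi psi).

   Polynomials are dense in L^1: the bounded f such that f p lies in the L^1-closure of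
   the polynomials for every polynomial p form an algebra, closed under bounded
   pointwise limits, which contains sin(t x_i) by its Taylor expansion. It therefore
   contains the indicators of a sigma-algebra for which the coordinates are measurable. *)

(** * Complex-valued integrals *)

(** The integral formula is two Mehler formulas sharing one variable [y]. With [psi = 1] it reads
    int phi(c x + s y) dmu(y), which is Gamma(c) phi; with [phi = 1] it is Gamma(s) psi, by the
    symmetry of mu. Since c^2 + s^2 = 1, the points c x + s y and s x - c y are independent standard
    Gaussians under mu (x) mu; this is why the estimate ends in a plain product of norms. The matrix
    has determinant -1, so that the map is its own inverse and undoing it means applying it once
    more.

    The link with the chaos definitions is a choice of test sequences. [wickGamma] speaks of every
    pair of L^2 sequences converging in L^1, so polynomial ones may be inserted. Their chaos
    expansions are finite, and each convergence demanded by [is_Gamma] and [is_wick] becomes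
    eventual equality.

    The inner integral converges absolutely only for almost every x, and for p = oo the bounds on
    phi and psi themselves hold only almost everywhere; that case therefore goes through
    representatives bounded at every point. *)

Section ComplexAbs.
Variable R : realType.
Implicit Types z w : R[i].
Local Notation Re := (@complex.Re R).
Local Notation Im := (@complex.Im R).

Lemma ReD z w : Re (z + w) = Re z + Re w. Proof. by case: z; case: w. Qed.
Lemma ImD z w : Im (z + w) = Im z + Im w. Proof. by case: z; case: w. Qed.
Lemma ReN z : Re (- z) = - Re z. Proof. by case: z. Qed.
Lemma ImN z : Im (- z) = - Im z. Proof. by case: z. Qed.
Lemma ReM z w : Re (z * w) = Re z * Re w - Im z * Im w.
Proof. by case: z; case: w. Qed.
Lemma ImM z w : Im (z * w) = Re z * Im w + Im z * Re w.
Proof. by case: z; case: w. Qed.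
Lemma ReJ z : Re (z^*)%C = Re z. Proof. by case: z. Qed.
Lemma ImJ z : Im (z^*)%C = - Im z. Proof. by case: z. Qed.

Lemma conjcD z w : conjc (z + w) = conjc z + conjc w.
Proof. by case: z w => [a b] [a' b']; congr (_ +i* _)%C; rewrite opprD. Qed.

Lemma complex_ext z w : Re z = Re w -> Im z = Im w -> z = w.
Proof. by case: z w => [a b] [c d] /= -> ->. Qed.

Lemma conjcM z w : conjc (z * w) = conjc z * conjc w.
Proof. by case: z w => [a b] [a' b']; apply: complex_ext => /=; ring. Qed.

Lemma conjcMJ z w : conjc (z * conjc w) = w * conjc z.
Proof. by case: z w => [a b] [a' b']; apply: complex_ext => /=; ring. Qed.

Lemma cabs_normc z : cabs z = complex.ComplexField.Normc.normc z.
Proof. by case: z. Qed.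

Lemma cabs_ge0 z : 0 <= cabs z. Proof. exact: sqrtr_ge0. Qed.

Lemma cabs0 : cabs (0 : R[i]) = 0.
Proof. by rewrite /cabs /= expr0n /= addr0 sqrtr0. Qed.

Lemma sqr_cabs z : cabs z ^+ 2 = Re z ^+ 2 + Im z ^+ 2.
Proof. by rewrite sqr_sqrtr// addr_ge0// sqr_ge0. Qed.

Lemma cabsD z w : cabs (z + w) <= cabs z + cabs w.
Proof. by rewrite !cabs_normc le_normcD. Qed.

Lemma cabsM z w : cabs (z * w) = cabs z * cabs w.
Proof. by rewrite !cabs_normc complex.ComplexField.Normc.normcM. Qed.

Lemma cabsN z : cabs (- z) = cabs z.
Proof. by rewrite !cabs_normc normcN. Qed.

Lemma cabsB z w : cabs (z - w) = cabs (w - z).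
Proof. by rewrite -cabsN opprB. Qed.

Lemma cabsJ z : cabs (z^*)%C = cabs z.
Proof. by rewrite /cabs ReJ ImJ sqrrN. Qed.

Lemma cabs_real (x : R) : cabs (x%:C)%C = `|x|.
Proof. by rewrite /cabs /= expr0n addr0 sqrtr_sqr. Qed.

Lemma Re_le_cabs z : `|Re z| <= cabs z.
Proof. by rewrite -sqrtr_sqr ler_wsqrtr// lerDl sqr_ge0. Qed.

Lemma Im_le_cabs z : `|Im z| <= cabs z.
Proof. by rewrite -sqrtr_sqr ler_wsqrtr// lerDr sqr_ge0. Qed.

Lemma mulJc z : (z^*)%C * z = ((cabs z ^+ 2)%:C)%C.
Proof.
rewrite sqr_cabs; case: z => a b; apply: complex_ext; rewrite ?ReM ?ImM /=; first by ring.
by rewrite mulNr mulrC subrr.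
Qed.

Lemma cabs_eq0 z : cabs z = 0 -> z = 0.
Proof.
rewrite cabs_normc; exact: complex.ComplexField.Normc.eq0_normc.
Qed.

End ComplexAbs.

Section ComplexIntegral.
Context d (T : measurableType d) (R : realType).
Variable mu : {measure set T -> \bar R}.
Implicit Types (f g : T -> R[i]).
Local Notation Re := (@complex.Re R).
Local Notation Im := (@complex.Im R).

Definition cmeas d' (T' : measurableType d') (f : T' -> R[i]) :=
  measurable_fun setT (fun x => Re (f x)) /\ measurable_fun setT (fun x => Im (f x)).

Lemma cmeas_cst (z : R[i]) : cmeas (fun _ : T => z).
Proof. by split; exact: measurable_cst. Qed.

Lemma cmeas_real (f : T -> R) : measurable_fun setT f -> cmeas (fun x => (f x)%:C)%C.
Proof. by move=> mf; split => //=; exact: measurable_cst. Qed.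

Lemma cmeasD f g : cmeas f -> cmeas g -> cmeas (fun x => f x + g x).
Proof.
move=> [f1 f2] [g1 g2]; split.
  by under eq_fun do rewrite ReD; exact: measurable_funD.
by under eq_fun do rewrite ImD; exact: measurable_funD.
Qed.

Lemma cmeasN f : cmeas f -> cmeas (fun x => - f x).
Proof.
move=> [f1 f2]; split.
  by under eq_fun do rewrite ReN; exact: measurableT_comp.
by under eq_fun do rewrite ImN; exact: measurableT_comp.
Qed.

Lemma cmeasB f g : cmeas f -> cmeas g -> cmeas (fun x => f x - g x).
Proof. by move=> mf mg; apply: cmeasD => //; exact: cmeasN. Qed.

Lemma cmeasM f g : cmeas f -> cmeas g -> cmeas (fun x => f x * g x).
Proof.
move=> [f1 f2] [g1 g2]; split.
  by under eq_fun do rewrite ReM; apply: measurable_funB; exact: measurable_funM.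
by under eq_fun do rewrite ImM; apply: measurable_funD; exact: measurable_funM.
Qed.

Lemma cmeasJ f : cmeas f -> cmeas (fun x => (f x)^*)%C.
Proof.
move=> [f1 f2]; split; first by under eq_fun do rewrite ReJ.
by under eq_fun do rewrite ImJ; exact: measurableT_comp.
Qed.

Lemma cmeas_comp d' (T' : measurableType d') (g : T' -> T) f :
  measurable_fun setT g -> cmeas f -> cmeas (fun x => f (g x)).
Proof.
move=> mg [f1 f2]; split.
  exact: (measurableT_comp f1 mg).
exact: (measurableT_comp f2 mg).
Qed.

Lemma measurable_cabs f : cmeas f -> measurable_fun setT (fun x => cabs (f x)).
Proof.
move=> [f1 f2]; rewrite /cabs.
apply: (@measurableT_comp _ _ _ _ _ _ (@Num.sqrt R)) => //.
  by apply: continuous_measurable_fun; exact: sqrt_continuous.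
by apply: measurable_funD; exact: measurable_funX.
Qed.

Lemma measurable_ecabs f : cmeas f -> measurable_fun setT (fun x => (cabs (f x))%:E).
Proof. by move=> mf; apply/measurable_EFinP; exact: measurable_cabs. Qed.

(** Taken componentwise, so that [cinner f g] is convertible to [cint] of [f x * (g x)^*] and the
    lemmas on [cint] transfer to inner products. *)
Definition cint f : R[i] :=
  Complex (Rintegral mu setT (fun x => Re (f x))) (Rintegral mu setT (fun x => Im (f x))).

Definition cintegrable f := cmeas f /\ (\int[mu]_x (cabs (f x))%:E < +oo)%E.

Lemma cintegrable_le f (g : T -> R) : cmeas f -> measurable_fun setT g ->
  (forall x, cabs (f x) <= g x) -> (\int[mu]_x (g x)%:E < +oo)%E -> cintegrable f.
Proof.
move=> mf mg fg; split => //; apply: le_lt_trans H.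
apply: ge0_le_integral => //.
- by move=> x _; rewrite lee_fin cabs_ge0.
- exact: measurable_ecabs.
- exact/measurable_EFinP.
- by move=> x _; rewrite lee_fin.
Qed.

Lemma integrable_le_cabs f (h : T -> R) : cintegrable f -> measurable_fun setT h ->
  (forall x, `|h x| <= cabs (f x)) -> mu.-integrable setT (fun x => (h x)%:E).
Proof.
move=> [mf fi] mh hf; apply/integrableP; split; first exact/measurable_EFinP.
apply: le_lt_trans fi; apply: ge0_le_integral => //.
- by apply: measurableT_comp => //; exact/measurable_EFinP.
- exact: measurable_ecabs.
- by move=> x _; rewrite lee_fin.
Qed.

Lemma cintegrable_Re f : cintegrable f -> mu.-integrable setT (fun x => (Re (f x))%:E).
Proof.
move=> fi; apply: (integrable_le_cabs fi); first exact: fi.1.1.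
by move=> x; exact: Re_le_cabs.
Qed.

Lemma cintegrable_Im f : cintegrable f -> mu.-integrable setT (fun x => (Im (f x))%:E).
Proof.
move=> fi; apply: (integrable_le_cabs fi); first exact: fi.1.2.
by move=> x; exact: Im_le_cabs.
Qed.

Lemma cintegrableD f g : cintegrable f -> cintegrable g -> cintegrable (fun x => f x + g x).
Proof.
move=> [mf fi] [mg gi]; apply: (@cintegrable_le _ (fun x => cabs (f x) + cabs (g x))).
- exact: cmeasD.
- by apply: measurable_funD; exact: measurable_cabs.
- by move=> x; exact: cabsD.
- under eq_integral do rewrite EFinD.
  rewrite ge0_integralD//; first exact: lte_add_pinfty.
  + by move=> x _; rewrite lee_fin cabs_ge0.
  + exact: measurable_ecabs.
  + by move=> x _; rewrite lee_fin cabs_ge0.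
  + exact: measurable_ecabs.
Qed.

Lemma ge0_integral_cabsZ (z : R[i]) f : cmeas f ->
  (\int[mu]_x (cabs (z * f x))%:E = (cabs z)%:E * \int[mu]_x (cabs (f x))%:E)%E.
Proof.
move=> mf; under eq_integral do rewrite cabsM EFinM.
rewrite ge0_integralZl//; first exact: measurable_ecabs.
  by move=> x _; rewrite lee_fin cabs_ge0.
by rewrite lee_fin cabs_ge0.
Qed.

Lemma cintegrableZ (z : R[i]) f : cintegrable f -> cintegrable (fun x => z * f x).
Proof.
move=> [mf fi]; split; first by apply: cmeasM => //; exact: cmeas_cst.
by rewrite ge0_integral_cabsZ// lte_mul_pinfty// lee_fin cabs_ge0.
Qed.

Lemma cintegrable0 : cintegrable (fun _ => 0).
Proof.
split; first exact: cmeas_cst.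
by under eq_integral do rewrite cabs0; rewrite integral0.
Qed.

Lemma cintegrableN f : cintegrable f -> cintegrable (fun x => - f x).
Proof.
move=> [mf fi]; split; first exact: cmeasN.
by under eq_integral do rewrite cabsN.
Qed.

Lemma cintegrableB f g : cintegrable f -> cintegrable g -> cintegrable (fun x => f x - g x).
Proof. by move=> fi gi; apply: cintegrableD => //; exact: cintegrableN. Qed.

Lemma cintD f g : cintegrable f -> cintegrable g ->
  cint (fun x => f x + g x) = cint f + cint g.
Proof.
move=> fi gi; apply: complex_ext; rewrite ?ReD ?ImD /=.
  rewrite -RintegralD//; try exact: cintegrable_Re.
  by apply: eq_Rintegral => x _; rewrite ReD.
rewrite -RintegralD//; try exact: cintegrable_Im.
by apply: eq_Rintegral => x _; rewrite ImD.
Qed.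

Lemma cintZ (z : R[i]) f : cintegrable f -> cint (fun x => z * f x) = z * cint f.
Proof.
move=> fi; have [fR fI] := (cintegrable_Re fi, cintegrable_Im fi).
have iZ (h : T -> R) k : mu.-integrable setT (fun x => (h x)%:E) ->
    mu.-integrable setT (fun x => (k * h x)%:E).
  by move=> hi; under eq_fun do rewrite EFinM; exact: integrableZl.
apply: complex_ext; rewrite ?ReM ?ImM /=.
  rewrite -!RintegralZl// -RintegralB//; try exact: iZ.
  by apply: eq_Rintegral => x _; rewrite ReM.
rewrite -!RintegralZl// -RintegralD//; try exact: iZ.
by apply: eq_Rintegral => x _; rewrite ImM.
Qed.

Lemma cint0 : cint (fun _ => 0) = 0.
Proof.
apply: complex_ext => /=; rewrite (@eq_Rintegral _ _ _ mu setT (fun=> 0 * 0)) ?RintegralZl ?mul0r//;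
  by try exact: integrable0.
Qed.

Lemma cintN f : cintegrable f -> cint (fun x => - f x) = - cint f.
Proof.
by move=> fi; rewrite -mulN1r -cintZ//; congr cint; apply/funext => x; rewrite mulN1r.
Qed.

Lemma cintB f g : cintegrable f -> cintegrable g ->
  cint (fun x => f x - g x) = cint f - cint g.
Proof. by move=> fi gi; rewrite cintD ?cintN//; exact: cintegrableN. Qed.

Lemma cintJ f : cintegrable f -> cint (fun x => (f x)^*)%C = ((cint f)^*)%C.
Proof.
move=> fi; apply: complex_ext; rewrite ?ReJ ?ImJ /=.
  by apply: eq_Rintegral => x _; rewrite ReJ.
rewrite -mulN1r -RintegralZl//; last exact: cintegrable_Im.
by apply: eq_Rintegral => x _; rewrite ImJ mulN1r.
Qed.

(* Test the real part of the integral against the conjugate of its own value. *)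
Lemma cabs_cint_le f : cmeas f ->
  ((cabs (cint f))%:E <= \int[mu]_x (cabs (f x))%:E)%E.
Proof.
move=> mf; have [fioo|] := ltP (\int[mu]_x (cabs (f x))%:E)%E +oo%E; last first.
  by rewrite leye_eq => /eqP ->; rewrite leey.
have fi : cintegrable f by [].
set z := cint f; have [z0|z0] := eqVneq (cabs z) 0.
  by rewrite z0 integral_ge0// => x _; rewrite lee_fin cabs_ge0.
have zpos : 0 < cabs z by rewrite lt_neqAle eq_sym z0 cabs_ge0.
have zfi := cintegrableZ (z^*)%C fi.
have H1 : cint (fun x => (z^*)%C * f x) = ((cabs z ^+ 2)%:C)%C.
  by rewrite cintZ// -/z mulJc.
have : ((cabs z ^+ 2)%:E <= (cabs z)%:E * \int[mu]_x (cabs (f x))%:E)%E.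
  have -> : cabs z ^+ 2 = Rintegral mu setT (fun x => Re ((z^*)%C * f x)).
    by have /(congr1 Re) /= <- := H1.
  rewrite /Rintegral fineK; last exact: (integrable_fin_num _ (cintegrable_Re zfi)).
  have -> : ((cabs z)%:E = (cabs (z^*)%C)%:E)%E by rewrite cabsJ.
  rewrite -ge0_integral_cabsZ//.
  apply: le_integral => //; first exact: (cintegrable_Re zfi).
    apply: (@integrable_le_cabs _ (fun x => cabs ((z^*)%C * f x)) zfi).
      exact/measurable_cabs/zfi.1.
    by move=> x; rewrite ger0_norm// cabs_ge0.
  by move=> x _; rewrite lee_fin (le_trans (ler_norm _))// Re_le_cabs.
have /fineK <- : (\int[mu]_x (cabs (f x))%:E)%E \is a fin_num.
  by rewrite ge0_fin_numE// integral_ge0// => x _; rewrite lee_fin cabs_ge0.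
by rewrite -EFinM !lee_fin expr2 ler_pM2l.
Qed.

End ComplexIntegral.

(** * The Gaussian measure and its reflections *)

Section NormalIntegral.
Variable R : realType.
Local Notation RR := (measurableTypeR R).
Local Notation leb := (@lebesgue_measure R).
Local Notation g := (@normal_pdf R 0 1).
Local Open Scope ereal_scope.

(** The image of Lebesgue measure under x -> a x + b, scaled by [a], gives half-open intervals their
    length, hence is Lebesgue measure by uniqueness. *)
Lemma ge0_integral_affine (F : RR -> \bar R) (a b : R) : (0 < a)%R ->
  measurable_fun [set: RR] F -> (forall x, 0 <= F x) ->
  \int[leb]_x F x = a%:E * \int[leb]_x F (a * x + b)%R.
Proof.
move=> a0 mF F0.
pose phi (x : RR) : RR := (a * x + b)%R.
have mphi : measurable_fun [set: RR] phi.
  by apply: measurable_funD => //; exact: mulrl_measurable.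
pose push : {measure set RR -> \bar R} :=
  measure_function_pushforward__canonical__measure_function_Measure leb mphi.
pose nu : {measure set RR -> \bar R} := mscale (NngNum (ltW a0)) push.
have E (A : set RR) : measurable A -> leb A = nu A.
  move=> mA; apply: lebesgue_measure_unique => // _ [[x y] _ <-].
  rewrite /nu /mscale/= /pushforward.
  rewrite [X in _ = _ * lebesgue_measure X](_ : _ = `]((x - b) / a)%R, ((y - b) / a)%R]%classic); last first.
    apply/seteqP; split => t /=; rewrite !in_itv/= /phi.
      by rewrite ltr_pdivrMr// ler_pdivlMr// ltrBlDr lerBrDr mulrC.
    by rewrite ltr_pdivrMr// ler_pdivlMr// ltrBlDr lerBrDr mulrC.
  rewrite !lebesgue_measure_itv/= !lte_fin ltr_pM2r ?invr_gt0// ltrD2r.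
  case: ifPn => _; last by rewrite mule0.
  rewrite -!EFinD -EFinM; congr EFin.
  by rewrite -mulrBl mulrC divfK ?gt_eqF//; ring.
rewrite (eq_measure_integral nu); last by move=> A mA _; exact: E.
rewrite [LHS]ge0_integral_mscale//; congr (_ * _).
by rewrite [LHS]ge0_integral_pushforward.
Qed.

(** Change of variables supplies an abstract Radon-Nikodym derivative; it equals the Gaussian
    density almost everywhere because both have the same integral over every measurable set. *)
Lemma ge0_integral_normal (F : RR -> \bar R) :
  measurable_fun [set: RR] F -> (forall x, 0 <= F x) ->
  \int[normal_prob 0 1]_x F x = \int[leb]_x (F x * (g x)%:E).
Proof.
move=> mF F0.
have dom := @normal_prob_dominates R 0 1.
rewrite -(Radon_Nikodym_SigmaFinite.change_of_variables dom)//.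
have fI := Radon_Nikodym_SigmaFinite.f_integrable dom.
have mf := measurable_int _ fI.
have mg : measurable_fun [set: RR] (EFin \o g).
  by apply/measurable_EFinP; exact: measurable_normal_pdf.
apply: ge0_ae_eq_integral => //.
- exact: emeasurable_funM.
- exact: emeasurable_funM.
- by move=> x _; rewrite mule_ge0// Radon_Nikodym_SigmaFinite.f_ge0.
- by move=> x _; rewrite mule_ge0// lee_fin normal_pdf_ge0.
apply: ae_eqe_mul2l.
apply: integral_ae_eq => // A _ mA.
by rewrite -Radon_Nikodym_SigmaFinite.f_integral.
Qed.

Lemma normal_pdfM_rot (x y x' y' : R) : (x ^+ 2 + y ^+ 2 = x' ^+ 2 + y' ^+ 2)%R ->
  (g x * g y = g x' * g y')%R.
Proof.
move=> e; rewrite !normal_pdfE ?oner_eq0// /normal_fun !subr0.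
rewrite mulrACA [RHS]mulrACA -!expRD; congr (_ * expR _)%R.
by rewrite -!mulrDl -!opprD e.
Qed.

(* Two affine changes of variable, [z = s y + c x] in the inner integral and then
   [x = s w + c z], with Tonelli in between. *)
Lemma normal_rotation (c s : R) (F : RR * RR -> \bar R) :
  (0 < s)%R -> (c ^+ 2 + s ^+ 2 = 1)%R ->
  measurable_fun [set: RR * RR] F -> (forall p, 0 <= F p) ->
  \int[normal_prob 0 1]_x \int[normal_prob 0 1]_y F (c * x + s * y, s * x - c * y)%R =
  \int[normal_prob 0 1]_x \int[normal_prob 0 1]_y F (x, y).
Proof.
move=> s0 cs mF F0.
have sn0 : s != 0%R by rewrite gt_eqF.
have g0 x : 0 <= (g x)%:E by rewrite lee_fin normal_pdf_ge0.
have mg : measurable_fun [set: RR] (EFin \o g).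
  by apply/measurable_EFinP; exact: measurable_normal_pdf.
have ml (a b : R) : measurable_fun [set: RR * RR] (fun p : RR * RR => a * p.1 + b * p.2)%R.
  by apply: measurable_funD; apply: measurable_funM => //.
have ml1 (a b x : R) : measurable_fun [set: RR] (fun y : RR => a * x + b * y)%R.
  by apply: measurable_funD => //; apply: measurable_funM => //.
have dbl (K : RR * RR -> \bar R) : measurable_fun [set: RR * RR] K -> (forall p, 0 <= K p) ->
    \int[normal_prob 0 1]_x \int[normal_prob 0 1]_y K (x, y) =
    \int[leb]_x \int[leb]_y (K (x, y) * (g y * g x)%:E).
  move=> mK K0; rewrite ge0_integral_normal.
  - apply: eq_integral => x _; rewrite ge0_integral_normal//.
    + rewrite -ge0_integralZr//.
      * by apply: eq_integral => y _; rewrite EFinM muleA.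
      * apply: emeasurable_funM => //; exact: (measurableT_comp mK).
      * by move=> y _; rewrite mule_ge0.
    + exact: (measurableT_comp mK).
  - exact: (measurable_fun_fubini_tonelli_F (m2 := normal_prob 0 1) K).
  - by move=> x; rewrite integral_ge0.
(* The integrand in the coordinates (x, z) with z = c x + s y: then y = (z - c x) / s, and s x - c y
   = (x - c z) / s because c^2 + s^2 = 1. The Jacobian 1/s is kept outside. *)
pose H (p : RR * RR) := F (p.2, (p.1 - c * p.2) / s)%R *
  (g ((p.2 - c * p.1) / s) * g p.1)%:E.
have mH : measurable_fun [set: RR * RR] H.
  apply: emeasurable_funM.
    apply: (measurableT_comp mF); apply: measurable_fun_pair => //=.
    apply: measurable_funM => //; apply: measurable_funB => //.
    by apply: measurable_funM.
  apply/measurable_EFinP; apply: measurable_funM.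
    apply: (measurableT_comp (measurable_normal_pdf 0 1)).
    apply: measurable_funM => //; apply: measurable_funB => //.
    by apply: measurable_funM.
  by apply: (measurableT_comp (measurable_normal_pdf 0 1)).
have H0 p : 0 <= H p by rewrite mule_ge0// lee_fin mulr_ge0// normal_pdf_ge0.
transitivity (\int[leb]_x \int[leb]_y H (x, s * y + c * x)%R).
  have mF' : measurable_fun [set: RR * RR]
      (fun p : RR * RR => F (c * p.1 + s * p.2, s * p.1 - c * p.2)%R).
    apply: (measurableT_comp mF); apply: measurable_fun_pair; first exact: ml.
    by under eq_fun do rewrite -mulNr; exact: ml.
  rewrite (dbl _ mF' (fun _ => F0 _)).
  apply: eq_integral => x _; apply: eq_integral => y _; rewrite /H/=.
  have -> : (s * y + c * x - c * x)%R = (s * y)%R by rewrite addrK.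
  rewrite [(s * y)%R]mulrC mulfK// [(y * s)%R]mulrC; congr (F (_, _) * _).
    by rewrite addrC.
  apply: (canRL (mulfK _)) => //.
  by transitivity (x * (c ^+ 2 + s ^+ 2) - c * (s * y + c * x))%R; [ring | rewrite cs mulr1].
have -> : \int[leb]_x \int[leb]_y H (x, s * y + c * x)%R =
    s^-1%:E * \int[leb]_x \int[leb]_y H (x, y).
  rewrite -ge0_integralZl//.
  - apply: eq_integral => x _.
    rewrite [X in _ = _ * X](@ge0_integral_affine _ s (c * x))//; last first.
      exact: (measurableT_comp mH).
    by rewrite muleA -EFinM mulVf// mul1e.
  - exact: (measurable_fun_fubini_tonelli_F (m2 := leb) H).
  - by move=> x _; rewrite integral_ge0.
  - by rewrite lee_fin invr_ge0 ltW.
rewrite (fubini_tonelli H)// -ge0_integralZl//.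
- rewrite dbl//; apply: eq_integral => z _.
  have mHz : measurable_fun [set: RR] (fun x => H (x, z)).
    exact: (measurable_fun_pair1 z mH).
  rewrite (ge0_integral_affine (c * z) s0 mHz (fun _ => H0 _)).
  rewrite muleA -EFinM mulVf// mul1e.
  apply: eq_integral => w _; rewrite /H/= addrK [(s * w)%R]mulrC mulfK//; congr (F _ * _%:E).
  apply: normal_pdfM_rot.
  have -> : ((z - c * (w * s + c * z)) / s = s * z - c * w)%R.
    apply: (canLR (mulfK _)) => //.
    by transitivity (z * (c ^+ 2 + s ^+ 2) - c * (w * s + c * z))%R; [rewrite cs mulr1 | ring].
  by transitivity ((w ^+ 2 + z ^+ 2) * (c ^+ 2 + s ^+ 2))%R; [ring | rewrite cs mulr1].
- exact: (measurable_fun_fubini_tonelli_G (m1 := leb) H).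
- by move=> x _; rewrite integral_ge0.
- by rewrite lee_fin invr_ge0 ltW.
Qed.

(** Completing the square turns e^(m t) times the density into e^(m^2/2) times the normal density of
    mean m, and e^(l|t|) is at most e^(l t) + e^(-l t). *)
Lemma normal_exp_moment (l : R) : (0 <= l)%R ->
  \int[normal_prob 0 1]_t (expR (l * `|t|))%:E < +oo.
Proof.
move=> l0.
have me (k : R) : measurable_fun [set: RR] (fun t : RR => expR (k * `|t|)).
  apply: measurableT_comp => //; apply: measurable_funM => //.
have shift (m t : R) : (expR (m * t) * g t = expR (m ^+ 2 / 2) * normal_pdf m 1 t)%R.
  rewrite !normal_pdfE ?oner_eq0// /normal_fun mulrCA [in RHS]mulrCA -!expRD.
  by congr (_ * expR _)%R; rewrite expr1n subr0 -mulr_natr mul1r; field.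
have mp m : measurable_fun [set: RR] (fun t => (expR (m ^+ 2 / 2) * normal_pdf m 1 t)%:E).
  apply/measurable_EFinP; apply: measurable_funM => //; exact: measurable_normal_pdf.
have p0 (m t : R) : (0 <= expR (m ^+ 2 / 2) * normal_pdf m 1 t)%R.
  by rewrite mulr_ge0 ?expR_ge0 ?normal_pdf_ge0.
rewrite ge0_integral_normal; last 2 first.
- by apply/measurable_EFinP; exact: me.
- by move=> t; rewrite lee_fin expR_ge0.
apply: (@le_lt_trans _ _ (\int[leb]_t
   ((expR (l ^+ 2 / 2) * normal_pdf l 1 t)%:E +
    (expR ((- l) ^+ 2 / 2) * normal_pdf (- l) 1 t)%:E))).
  apply: ge0_le_integral => //.
  - by move=> t _; rewrite -EFinM lee_fin mulr_ge0 ?expR_ge0 ?normal_pdf_ge0.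
  - by apply: emeasurable_funM; apply/measurable_EFinP => //; exact: measurable_normal_pdf.
  - by apply: emeasurable_funD.
  move=> t _; rewrite -EFinM -EFinD lee_fin -(shift l t) -(shift (- l)%R t) -mulrDl.
  apply: ler_wpM2r; first exact: normal_pdf_ge0.
  have [t0|t0] := leP 0%R t; first by rewrite ger0_norm// lerDl expR_ge0.
  by rewrite ltr0_norm// mulrN mulNr lerDr expR_ge0.
rewrite ge0_integralD//; try by move=> t _; rewrite lee_fin.
have fin m : \int[leb]_t (expR (m ^+ 2 / 2) * normal_pdf m 1 t)%:E < +oo.
  under eq_integral do rewrite EFinM.
  rewrite ge0_integralZl; last 4 first.
  - by [].
  - by apply/measurable_EFinP; exact: measurable_normal_pdf.
  - by move=> t _; rewrite lee_fin normal_pdf_ge0.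
  - by rewrite lee_fin expR_ge0.
  by rewrite integral_normal_pdf mule1 ltry.
by apply: lte_add_pinfty.
Qed.

End NormalIntegral.

(** * Reflection invariance and exponential moments in dimension d *)

Section GaussIntegral.
Variable R : realType.
Local Notation RR := (measurableTypeR R).
Local Notation gam := (@gauss_measure R).
Local Notation nu := (@normal_prob R 0 1).

Lemma ge0_integral_gaussS d (F : Rdim R d.+1 -> \bar R) :
  measurable_fun setT F -> (forall x, 0 <= F x)%E ->
  (\int[gam d.+1]_x F x = \int[nu]_t \int[gam d]_x F (tcons (t, x)))%E.
Proof.
move=> mF F0; rewrite [LHS]ge0_integral_distribution//.
have mG : measurable_fun setT (F \o @tcons R d).
  exact: (measurableT_comp mF (@measurable_tcons R d)).
by rewrite [LHS](fubini_tonelli1 _ mG (fun _ => F0 _)).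
Qed.

Definition lincomb d (a b : R) (x y : Rdim R d) : Rdim R d :=
  [tuple a * tnth x i + b * tnth y i | i < d].

Lemma lincomb_tcons d a b t t' (x y : Rdim R d) :
  lincomb a b (tcons (t, x)) (tcons (t', y)) = tcons (a * t + b * t', lincomb a b x y).
Proof.
apply: eq_from_tnth => i; rewrite tnth_mktuple.
have [j ->|->] := unliftP ord0 i; last by [].
by rewrite !tnthS tnth_mktuple.
Qed.

Lemma measurable_lincomb d (a b : R) :
  measurable_fun setT (fun p : Rdim R d * Rdim R d => lincomb a b p.1 p.2).
Proof.
apply/measurable_fun_tnthP => i /=.
rewrite (_ : _ \o _ = fun p : Rdim R d * Rdim R d => a * tnth p.1 i + b * tnth p.2 i); last first.
  by apply/funext => p /=; rewrite tnth_mktuple.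
apply: measurable_funD; apply: measurable_funM => //.
  exact: (measurableT_comp (measurable_tnth i)).
exact: (measurableT_comp (measurable_tnth i)).
Qed.

Definition prot d (c s : R) (p : Rdim R d * Rdim R d) :=
  (lincomb c s p.1 p.2, lincomb s (- c) p.1 p.2).

Lemma measurable_prot d (c s : R) : measurable_fun setT (@prot d c s).
Proof. by apply: measurable_fun_pair; exact: measurable_lincomb. Qed.

(** The map acts on each pair of coordinates (x_i, y_i) separately. Tonelli brings the first pair
    outside; the induction hypothesis treats the inner integrals and [normal_rotation] the outer
    ones. *)
Lemma gauss_rotation_iter d (c s : R) (F : Rdim R d * Rdim R d -> \bar R) :
  0 < s -> c ^+ 2 + s ^+ 2 = 1 ->
  measurable_fun setT F -> (forall p, 0 <= F p)%E ->
  (\int[gam d]_x \int[gam d]_y F (prot c s (x, y)) =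
   \int[gam d]_x \int[gam d]_y F (x, y))%E.
Proof.
move=> s0 cs; elim: d F => [|d IH] F mF F0.
  apply: eq_integral => x _; apply: eq_integral => y _; congr F.
  by congr (_, _); rewrite [LHS]tuple0 [RHS]tuple0.
(* Peeling one coordinate off each variable gives the order t, x, t', y, so a single exchange of x
   and t' is left. *)
have expand (G : Rdim R d.+1 * Rdim R d.+1 -> \bar R) :
    measurable_fun setT G -> (forall p, 0 <= G p)%E ->
    (\int[gam d.+1]_x \int[gam d.+1]_y G (x, y) =
     \int[nu]_t \int[nu]_t' \int[gam d]_x \int[gam d]_y G (tcons (t, x), tcons (t', y)))%E.
  move=> mG G0; rewrite ge0_integral_gaussS; last 2 first.
  - exact: (measurable_fun_fubini_tonelli_F (m2 := gam d.+1) G).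
  - by move=> x; rewrite integral_ge0.
  apply: eq_integral => t _.
  under eq_integral => x _.
    rewrite ge0_integral_gaussS//; last exact: (measurableT_comp mG).
    over.
  have mG2 : measurable_fun setT (fun p : (Rdim R d * RR) * Rdim R d =>
      G (tcons (t, p.1.1), tcons (p.1.2, p.2))).
    apply: (measurableT_comp mG); apply: measurable_fun_pair.
      apply: (measurableT_comp (@measurable_tcons R d)).
      apply: measurable_fun_pair => //=; exact: (measurableT_comp measurable_fst).
    apply: (measurableT_comp (@measurable_tcons R d)).
    apply: measurable_fun_pair => //=; exact: (measurableT_comp measurable_snd).
  have := @fubini_tonelli _ _ (Rdim R d) RR R (gam d) nu (fun p =>
    \int[gam d]_y G (tcons (t, p.1), tcons (p.2, y)))%E.
  apply.
  - exact: (measurable_fun_fubini_tonelli_F (m2 := gam d) _ mG2).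
  - by move=> p; rewrite integral_ge0.
have mFr : measurable_fun setT (F \o @prot d.+1 c s).
  exact: (measurableT_comp mF (@measurable_prot d.+1 c s)).
rewrite (expand _ mFr (fun _ => F0 _)) (expand _ mF F0).
(* What remains of [F] as a function of the first pair of coordinates once all the others are
   integrated out. *)
pose K (p : RR * RR) := (\int[gam d]_x \int[gam d]_y F (tcons (p.1, x), tcons (p.2, y)))%E.
have mK : measurable_fun setT K.
  have m3 : measurable_fun setT (fun q : ((RR * RR) * Rdim R d) * Rdim R d =>
      F (tcons (q.1.1.1, q.1.2), tcons (q.1.1.2, q.2))).
    apply: (measurableT_comp mF); apply: measurable_fun_pair.
      apply: (measurableT_comp (@measurable_tcons R d)).
      apply: measurable_fun_pair => //=.
        by do 2 apply: (measurableT_comp measurable_fst) => //.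
      exact: (measurableT_comp measurable_snd).
    apply: (measurableT_comp (@measurable_tcons R d)).
    apply: measurable_fun_pair => //=.
    by apply: (measurableT_comp measurable_snd); exact: (measurableT_comp measurable_fst).
  have m2 := measurable_fun_fubini_tonelli_F (m2 := gam d) _ m3 (fun _ => F0 _).
  apply: (measurable_fun_fubini_tonelli_F (m2 := gam d) _ m2).
  by move=> p; apply: integral_ge0.
have K0 p : (0 <= K p)%E by apply: integral_ge0 => x _; exact: integral_ge0.
rewrite -[RHS](normal_rotation s0 cs mK K0).
apply: eq_integral => t _; apply: eq_integral => t' _; rewrite /K/=.
have mF' : measurable_fun setT (fun p : Rdim R d * Rdim R d =>
    F (tcons (c * t + s * t', p.1), tcons (s * t - c * t', p.2))).
  apply: (measurableT_comp mF); apply: measurable_fun_pair.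
    apply: (measurableT_comp (@measurable_tcons R d)).
    exact: measurable_fun_pair.
  apply: (measurableT_comp (@measurable_tcons R d)).
  exact: measurable_fun_pair.
rewrite -[RHS](IH _ mF' (fun _ => F0 _)).
apply: eq_integral => x _; apply: eq_integral => y _.
by rewrite /prot/= !lincomb_tcons mulNr.
Qed.

Lemma ge0_gauss_rotation d (c s : R) (F : Rdim R d * Rdim R d -> \bar R) :
  0 < s -> c ^+ 2 + s ^+ 2 = 1 ->
  measurable_fun setT F -> (forall p, 0 <= F p)%E ->
  (\int[gam d \x gam d]_p F (prot c s p) = \int[gam d \x gam d]_p F p)%E.
Proof.
move=> s0 cs mF F0.
have mFr : measurable_fun setT (F \o @prot d c s).
  exact: (measurableT_comp mF (@measurable_prot d c s)).
rewrite (fubini_tonelli1 _ mFr (fun _ => F0 _)) (fubini_tonelli1 _ mF F0).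
exact: gauss_rotation_iter.
Qed.

Lemma gauss_rotation d (c s : R) (F : Rdim R d * Rdim R d -> \bar R) :
  0 < s -> c ^+ 2 + s ^+ 2 = 1 -> measurable_fun setT F ->
  (\int[gam d \x gam d]_p F (prot c s p) = \int[gam d \x gam d]_p F p)%E.
Proof.
move=> s0 cs mF; rewrite integralE [RHS]integralE.
have -> : ((fun p => F (prot c s p))^\+ = fun p => F^\+ (prot c s p))%E.
  by apply/funext => p; rewrite !funeposE.
have -> : ((fun p => F (prot c s p))^\- = fun p => F^\- (prot c s p))%E.
  by apply/funext => p; rewrite !funenegE.
rewrite (ge0_gauss_rotation s0 cs (measurable_funepos mF) (fun p => funepos_ge0 F p)).
by rewrite (ge0_gauss_rotation s0 cs (measurable_funeneg mF) (fun p => funeneg_ge0 F p)).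
Qed.

(** One family of dominating functions for the whole proof: it majorizes polynomials and the Taylor
    sums of sin(t x_i), is multiplicative in [l], and factors over the coordinates, so its integral
    reduces to one-dimensional moments. *)
Definition expsum d (l : R) (x : Rdim R d) : R := expR (l * \sum_(i < d) `|tnth x i|).

Lemma measurable_expsum d l : measurable_fun setT (@expsum d l).
Proof.
apply: measurableT_comp => //; apply: measurable_funM => //.
apply: measurable_sum => i; apply: measurableT_comp => //; exact: measurable_tnth.
Qed.

Lemma expsum_ge0 d l (x : Rdim R d) : 0 <= expsum l x. Proof. exact: expR_ge0. Qed.

Lemma expsum_int d (l : R) : 0 <= l -> (\int[gam d]_x (expsum l x)%:E < +oo)%E.
Proof.
move=> l0; elim: d => [|d IH].
  rewrite [X in (X < _)%E]integral_dirac//; first by rewrite diracT mul1e ltry.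
  by apply/measurable_EFinP; exact: measurable_expsum.
rewrite ge0_integral_gaussS; last 2 first.
- by apply/measurable_EFinP; exact: measurable_expsum.
- by move=> x; rewrite lee_fin expsum_ge0.
have me : measurable_fun setT (fun x : Rdim R d => (expsum l x)%:E).
  by apply/measurable_EFinP; exact: measurable_expsum.
have -> : (\int[nu]_t \int[gam d]_x (expsum l (tcons (t, x)))%:E =
    \int[nu]_t ((expR (l * `|t|))%:E * \int[gam d]_x (expsum l x)%:E))%E.
  apply: eq_integral => t _; rewrite -ge0_integralZl//.
  - apply: eq_integral => x _; rewrite -EFinM; congr EFin.
    rewrite /expsum big_ord_recl /= mulrDr expRD; congr (_ * expR (_ * _)).
    by apply: eq_bigr => i _; rewrite tnthS.
  - by move=> x _; rewrite lee_fin expsum_ge0.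
rewrite ge0_integralZr//.
- apply: lte_mul_pinfty => //.
  + by apply: integral_ge0 => t _; rewrite lee_fin expR_ge0.
  + rewrite ge0_fin_numE ?normal_exp_moment//.
    by apply: integral_ge0 => t _; rewrite lee_fin expR_ge0.
- apply/measurable_EFinP; apply: measurableT_comp => //.
  exact: measurable_funM.
- by apply: integral_ge0 => t _; rewrite lee_fin expsum_ge0.
Qed.

End GaussIntegral.

(** * The integral formula on L^p *)

Section GaussLp.
Variables (R : realType) (d : nat).
Local Notation X := (Rdim R d).
Local Notation gam := (@gauss_measure R d).
Implicit Types (f g : X -> R[i]).

Lemma gauss_setT : gam setT = 1%E. Proof. exact: probability_setT. Qed.

Lemma Lpnorm1E f : Lpnorm 1 f = (\int[gam]_x (cabs (f x))%:E)%E.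
Proof.
rewrite /Lpnorm Lnorm1; apply: eq_integral => x _.
by rewrite gee0_abs// lee_fin cabs_ge0.
Qed.

Lemma inLp1P f : inLp 1 f <-> cintegrable gam f.
Proof. by rewrite /inLp Lpnorm1E. Qed.

Lemma LpnormyE f : Lpnorm +oo f = ess_sup gam (fun x => (cabs (f x))%:E).
Proof.
rewrite /Lpnorm unlock /= gauss_setT lte01; congr ess_sup.
by apply/funext => x /=; rewrite ger0_norm// cabs_ge0.
Qed.

Lemma LpnormrE (r : R) f :
  Lpnorm r%:E f = ((\int[gam]_x ((cabs (f x))%:E `^ r)) `^ r^-1)%E.
Proof.
rewrite /Lpnorm unlock /=; apply: (congr1 (fun z => z `^ r^-1)%E); apply: eq_integral => x _.
by rewrite ger0_norm// cabs_ge0.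
Qed.

Lemma cabs_sub_int0_ae f g : cmeas f -> cmeas g ->
  (\int[gam]_x (cabs (f x - g x))%:E = 0)%E -> {ae gam, forall x, f x = g x}.
Proof.
move=> mf mg fg0.
have m : measurable_fun setT (fun x => (cabs (f x - g x))%:E).
  by apply: measurable_ecabs; exact: cmeasB.
have : (\int[gam]_x `|(cabs (f x - g x))%:E| = 0)%E.
  rewrite -fg0; apply: eq_integral => x _.
  by rewrite gee0_abs// lee_fin cabs_ge0.
move/(ae_eq_integral_abs gam measurableT m).
apply: filterS => x /= /(_ I) [] /cabs_eq0 /eqP.
by rewrite subr_eq0 => /eqP.
Qed.

Lemma Lpnorm_ae p f g : cmeas f -> cmeas g -> (1 <= p)%E ->
  {ae gam, forall x, f x = g x} -> Lpnorm p f = Lpnorm p g.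
Proof.
move=> mf mg; case: p => [r r1|_|//] fg.
  rewrite !LpnormrE; apply: (congr1 (fun z => z `^ r^-1)%E); apply: ae_eq_integral.
  - by [].
  - apply: (measurableT_comp (measurable_poweR _)); exact: measurable_ecabs.
  - apply: (measurableT_comp (measurable_poweR _)); exact: measurable_ecabs.
  - by apply: filterS fg => x /= ->.
by rewrite !LpnormyE; apply: eq_ess_sup; apply: filterS fg => x ->.
Qed.

(** Hoelder's inequality against the constant 1, whose norm is 1 under a probability measure. The
    conjugate exponent r / (r - 1) degenerates at r = 1, which is treated apart. *)
Lemma gauss_jensen (r : R) (h : X -> R) : 1 <= r -> measurable_fun setT h ->
  (forall x, 0 <= h x) ->
  ((\int[gam]_x (h x)%:E) `^ r <= \int[gam]_x ((h x)%:E `^ r))%E.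
Proof.
move=> r1 mh h0; have r0 : 0 < r by apply: lt_le_trans r1.
rewrite le_eqVlt in r1; case/predU1P: r1 => [<-|r1].
  rewrite poweRe1; last by apply: integral_ge0 => x _; rewrite lee_fin.
  rewrite le_eqVlt; apply/orP; left; apply/eqP; apply: eq_integral => x _.
  by rewrite poweRe1// lee_fin.
pose q := r / (r - 1).
have r10 : 0 < r - 1 by rewrite subr_gt0.
have q0 : 0 < q by rewrite divr_gt0.
have rq : r^-1 + q^-1 = 1.
  by rewrite /q invf_div; field; rewrite gt_eqF.
have := @hoelder _ X R gam h (cst 1) r q mh (measurable_cst _) r0 q0 rq.
rewrite Lnorm1.
under eq_integral => x _ do rewrite /= mulr1 ger0_norm//.
rewrite (_ : EFin \o cst 1 = cst 1%E)// Lnorm_cst1.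
rewrite [X in (_ * X `^ _)%E](_ : _ = 1%E); last exact: gauss_setT.
rewrite poweR1r mule1.
move=> H; apply: (@le_trans _ _ (Lnorm gam r%:E (EFin \o h) `^ r)%E).
  apply: gt0_ler_poweR => //; first exact: ltW.
    rewrite in_itv/= leey andbT; apply: integral_ge0 => x _.
    by rewrite lee_fin.
  by rewrite in_itv/= leey andbT Lnorm_ge0.
rewrite poweR_Lnorm ?gt_eqF// le_eqVlt; apply/orP; left; apply/eqP.
by apply: eq_integral => x _; rewrite /= ger0_norm.
Qed.

End GaussLp.

(** * The integral operator and its norm estimates *)

Section WickIntegral.
Variables (R : realType) (d : nat) (c s : R).
Hypotheses (s0 : 0 < s) (cs : c ^+ 2 + s ^+ 2 = 1).
Local Notation X := (Rdim R d).
Local Notation gam := (@gauss_measure R d).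
Implicit Types (f g phi psi : X -> R[i]).

Definition tens phi psi (p : X * X) := phi p.1 * psi p.2.

(** Defined at every [x]: where the inner integral does not converge absolutely the value is a
    convention. [wickint_le] survives there because its right-hand side is infinite, whereas
    linearity is available only for almost every [x]. *)
Definition wickint phi psi (x : X) : R[i] :=
  cint gam (fun y => tens phi psi (prot c s (x, y))).

Lemma cmeas_tens phi psi : cmeas phi -> cmeas psi -> cmeas (tens phi psi).
Proof. by move=> m1 m2; apply: cmeasM; [apply: cmeas_comp m1|apply: cmeas_comp m2]. Qed.

Lemma cmeas_tens_rot phi psi : cmeas phi -> cmeas psi ->
  cmeas (fun p => tens phi psi (prot c s p)).
Proof.
by move=> m1 m2; apply: (cmeas_comp (@measurable_prot R d c s)); exact: cmeas_tens.
Qed.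

Lemma cmeas_tens_rot1 phi psi x : cmeas phi -> cmeas psi ->
  cmeas (fun y => tens phi psi (prot c s (x, y))).
Proof.
by move=> m1 m2; apply: (cmeas_comp _ (cmeas_tens_rot m1 m2)); exact: pair1_measurable.
Qed.

(** Invariance under [prot] replaces the two coupled arguments by independent variables, after which
    the double integral factors. Every product of norms below comes from here. *)
Lemma ge0_integral_tens_rot (f g : X -> \bar R) :
  measurable_fun setT f -> measurable_fun setT g ->
  (forall x, 0 <= f x)%E -> (forall x, 0 <= g x)%E ->
  (\int[gam]_x \int[gam]_y (f (prot c s (x, y)).1 * g (prot c s (x, y)).2) =
   (\int[gam]_x f x) * \int[gam]_x g x)%E.
Proof.
move=> mf mg f0 g0.
have m : measurable_fun setT (fun p : X * X => f p.1 * g p.2)%E.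
  by apply: emeasurable_funM; [exact: (measurableT_comp mf)|exact: (measurableT_comp mg)].
rewrite (gauss_rotation_iter s0 cs m (fun p => mule_ge0 (f0 _) (g0 _))).
rewrite -ge0_integralZr//; last by apply: integral_ge0.
by apply: eq_integral => x _; rewrite /= ge0_integralZl.
Qed.

Lemma integral_cabs_tens_rot phi psi : cmeas phi -> cmeas psi ->
  (\int[gam]_x \int[gam]_y (cabs (tens phi psi (prot c s (x, y))))%:E =
   (\int[gam]_x (cabs (phi x))%:E) * \int[gam]_x (cabs (psi x))%:E)%E.
Proof.
move=> m1 m2.
rewrite -(ge0_integral_tens_rot (measurable_ecabs m1) (measurable_ecabs m2)); last 2 first.
- by move=> x; rewrite lee_fin cabs_ge0.
- by move=> x; rewrite lee_fin cabs_ge0.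
by apply: eq_integral => x _; apply: eq_integral => y _; rewrite cabsM EFinM.
Qed.

Lemma cintegrable_tens_rot phi psi : cintegrable gam phi -> cintegrable gam psi ->
  cintegrable (gam \x gam)%E (fun p => tens phi psi (prot c s p)).
Proof.
move=> [m1 i1] [m2 i2]; have m := cmeas_tens_rot m1 m2; split => //.
rewrite (fubini_tonelli1 _ (measurable_ecabs m)); last first.
  by move=> p; rewrite lee_fin cabs_ge0.
rewrite [X in (X < _)%E](integral_cabs_tens_rot m1 m2).
apply: lte_mul_pinfty => //.
  by apply: integral_ge0 => x _; rewrite lee_fin cabs_ge0.
rewrite ge0_fin_numE//.
by apply: integral_ge0 => x _; rewrite lee_fin cabs_ge0.
Qed.

Lemma ae_cintegrable_tens_rot phi psi : cintegrable gam phi -> cintegrable gam psi ->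
  {ae gam, forall x, cintegrable gam (fun y => tens phi psi (prot c s (x, y)))}.
Proof.
move=> i1 i2; have i := cintegrable_tens_rot i1 i2.
have /integrableP[mi fi] : (gam \x gam)%E.-integrable setT
    (fun p => (cabs (tens phi psi (prot c s p)))%:E).
  apply: (integrable_le_cabs i); first exact: measurable_cabs i.1.
  by move=> p; rewrite ger0_norm// cabs_ge0.
have := ae_integrable1 (m1 := gam) (m2 := gam).
move=> /(_ (fun p => (cabs (tens phi psi (prot c s p)))%:E)).
move=> /(_ _)/=; have h := integrable_le_cabs i (measurable_cabs i.1).
move=> /(_ (h (fun p => _))) H.
apply: filterS (H _) => [x /integrableP[mx ix]|p].
  split; first exact: (cmeas_tens_rot1 _ i1.1 i2.1).
  apply: le_lt_trans ix; apply: ge0_le_integral => //.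
  - by move=> y _; rewrite lee_fin cabs_ge0.
  - exact: measurableT_comp.
  - by move=> y _; rewrite gee0_abs// lee_fin cabs_ge0.
by rewrite ger0_norm// cabs_ge0.
Qed.

Lemma cmeas_wickint phi psi : cintegrable gam phi -> cintegrable gam psi ->
  cmeas (wickint phi psi).
Proof.
move=> i1 i2; have i := cintegrable_tens_rot i1 i2; split.
  apply: (measurableT_comp (fine_measurable measurableT)).
  exact: (measurable_fubini_F (m1 := gam) (m2 := gam) (cintegrable_Re i)).
apply: (measurableT_comp (fine_measurable measurableT)).
exact: (measurable_fubini_F (m1 := gam) (m2 := gam) (cintegrable_Im i)).
Qed.

Lemma wickint_le phi psi x : cmeas phi -> cmeas psi ->
  ((cabs (wickint phi psi x))%:E <=
   \int[gam]_y (cabs (tens phi psi (prot c s (x, y))))%:E)%E.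
Proof. by move=> m1 m2; apply: cabs_cint_le; exact: cmeas_tens_rot1. Qed.

Lemma cintegrable_wickint phi psi : cintegrable gam phi -> cintegrable gam psi ->
  cintegrable gam (wickint phi psi).
Proof.
move=> i1 i2; have m := cmeas_wickint i1 i2; split => //.
have mm := measurable_ecabs (cmeas_tens_rot i1.1 i2.1).
have F0 p : (0 <= (cabs (tens phi psi (prot c s p)))%:E)%E by rewrite lee_fin cabs_ge0.
apply: (@le_lt_trans _ _ (\int[gam]_x \int[gam]_y (cabs (tens phi psi (prot c s (x, y))))%:E)%E).
  apply: ge0_le_integral => //.
  - by move=> x _; rewrite lee_fin cabs_ge0.
  - exact: measurable_ecabs.
  - exact: (measurable_fun_fubini_tonelli_F (m2 := gam) _ mm).
  - by move=> x _; apply: wickint_le; [exact: i1.1|exact: i2.1].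
rewrite integral_cabs_tens_rot; [|exact: i1.1|exact: i2.1].
apply: lte_mul_pinfty; last exact: i2.2.
  by apply: integral_ge0 => x _; rewrite lee_fin cabs_ge0.
rewrite ge0_fin_numE; first exact: i1.2.
by apply: integral_ge0 => x _; rewrite lee_fin cabs_ge0.
Qed.

(** Bilinearity in the form ab - a'b' = (a - a')b + a'(b - b') under the inner integral. Subtracting
    the two inner integrals requires both to converge, hence the comparison for almost every x
    only. *)
Lemma wickint_L1_dist phi psi phi' psi' :
  cintegrable gam phi -> cintegrable gam psi ->
  cintegrable gam phi' -> cintegrable gam psi' ->
  (\int[gam]_x (cabs (wickint phi psi x - wickint phi' psi' x))%:E <=
   (\int[gam]_x (cabs (phi x - phi' x))%:E) * (\int[gam]_x (cabs (psi x))%:E) +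
   (\int[gam]_x (cabs (phi' x))%:E) * (\int[gam]_x (cabs (psi x - psi' x))%:E))%E.
Proof.
move=> i1 i2 i1' i2'.
have iB1 := cintegrableB i1 i1'; have iB2 := cintegrableB i2 i2'.
have m1 := cmeas_tens_rot iB1.1 i2.1; have m2 := cmeas_tens_rot i1'.1 iB2.1.
pose D1 p := (cabs (tens (fun x => phi x - phi' x) psi (prot c s p)))%:E.
pose D2 p := (cabs (tens phi' (fun x => psi x - psi' x) (prot c s p)))%:E.
have mD1 : measurable_fun setT D1 by exact: measurable_ecabs.
have mD2 : measurable_fun setT D2 by exact: measurable_ecabs.
have D10 p : (0 <= D1 p)%E by rewrite lee_fin cabs_ge0.
have D20 p : (0 <= D2 p)%E by rewrite lee_fin cabs_ge0.
have mI1 := measurable_fun_fubini_tonelli_F (m2 := gam) _ mD1 D10.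
have mI2 := measurable_fun_fubini_tonelli_F (m2 := gam) _ mD2 D20.
rewrite -(integral_cabs_tens_rot iB1.1 i2.1) -(integral_cabs_tens_rot i1'.1 iB2.1).
rewrite -ge0_integralD//; last 2 first.
- by move=> x _; apply: integral_ge0 => y _; exact: D10.
- by move=> x _; apply: integral_ge0 => y _; exact: D20.
apply: ae_ge0_le_integral => //.
- by move=> x _; rewrite lee_fin cabs_ge0.
- by apply: measurable_ecabs; apply: cmeasB; exact: cmeas_wickint.
- by move=> x _; apply: adde_ge0; apply: integral_ge0 => y _; [exact: D10|exact: D20].
- exact: emeasurable_funD.
apply: filterS2 (ae_cintegrable_tens_rot i1 i2) (ae_cintegrable_tens_rot i1' i2').
move=> x j j' _; rewrite /wickint -cintB//.
have mx : cmeas (fun y => tens phi psi (prot c s (x, y)) - tens phi' psi' (prot c s (x, y))).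
  exact: (cintegrableB j j').1.
apply: (le_trans (cabs_cint_le _ mx)).
have mD1x : measurable_fun setT (fun y => D1 (x, y)) by exact: (measurable_fun_pair2 x mD1).
have mD2x : measurable_fun setT (fun y => D2 (x, y)) by exact: (measurable_fun_pair2 x mD2).
rewrite -ge0_integralD//; last 2 first.
- by move=> y _; exact: D10.
- by move=> y _; exact: D20.
apply: ge0_le_integral => //.
- by move=> y _; rewrite lee_fin cabs_ge0.
- exact: measurable_ecabs.
- exact: emeasurable_funD.
move=> y _; rewrite /D1 /D2 -EFinD lee_fin /tens.
set a := phi _; set a' := phi' _; set b := psi _; set b' := psi' _.
have -> : a * b - a' * b' = (a - a') * b + a' * (b - b') by ring.
exact: cabsD.
Qed.

Lemma wickint_Lp_fin (r : R) phi psi : 1 <= r ->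
  cintegrable gam phi -> cintegrable gam psi ->
  (Lpnorm r%:E (wickint phi psi) <= Lpnorm r%:E phi * Lpnorm r%:E psi)%E.
Proof.
move=> r1 i1 i2; have r0 : 0 < r by apply: lt_le_trans r1.
have mT := cmeas_wickint i1 i2.
rewrite !LpnormrE.
have pw0 f : (0 <= \int[gam]_x ((cabs (f x))%:E `^ r))%E.
  by apply: integral_ge0 => x _; exact: poweR_ge0.
rewrite -poweRM//; apply: gt0_ler_poweR; rewrite ?invr_ge0 ?(ltW r0)//.
- by rewrite in_itv/= leey andbT pw0.
- by rewrite in_itv/= leey andbT mule_ge0 ?pw0.
have mp f : cmeas f -> measurable_fun setT (fun x => (cabs (f x))%:E `^ r)%E.
  by move=> mf; apply: (measurableT_comp (measurable_poweR _)); exact: measurable_ecabs.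
rewrite -(ge0_integral_tens_rot (mp _ i1.1) (mp _ i2.1)); last 2 first.
- by move=> x; exact: poweR_ge0.
- by move=> x; exact: poweR_ge0.
have mt : measurable_fun setT (fun p => (cabs (tens phi psi (prot c s p)))%:E `^ r)%E.
  apply: (measurableT_comp (measurable_poweR _)); apply: measurable_ecabs.
  exact: (cmeas_tens_rot i1.1 i2.1).
have -> : (\int[gam]_x \int[gam]_y ((cabs (phi (prot c s (x, y)).1))%:E `^ r *
      (cabs (psi (prot c s (x, y)).2))%:E `^ r) =
    \int[gam]_x \int[gam]_y ((cabs (tens phi psi (prot c s (x, y))))%:E `^ r))%E.
  apply: eq_integral => x _; apply: eq_integral => y _.
  by rewrite cabsM EFinM poweRM// lee_fin cabs_ge0.
apply: ge0_le_integral => //.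
- by move=> x _; exact: poweR_ge0.
- exact: mp.
- by apply: (measurable_fun_fubini_tonelli_F (m2 := gam) _ mt) => p; exact: poweR_ge0.
move=> x _.
have mx := cmeas_tens_rot1 x i1.1 i2.1.
apply: (@le_trans _ _ ((\int[gam]_y (cabs (tens phi psi (prot c s (x, y))))%:E) `^ r)%E).
  apply: gt0_ler_poweR; rewrite ?(ltW r0)//.
  - by rewrite in_itv/= leey andbT lee_fin cabs_ge0.
  - rewrite in_itv/= leey andbT; apply: integral_ge0 => y _.
    by rewrite lee_fin cabs_ge0.
  - by apply: wickint_le; [exact: i1.1|exact: i2.1].
apply: gauss_jensen => //; first exact: measurable_cabs.
by move=> y; exact: cabs_ge0.
Qed.

(** [f'] is [f] cut to zero where its modulus exceeds the essential supremum. A bound valid at every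
    point can be composed with [prot] without tracing null sets through the reflection. *)
Lemma truncation f : cintegrable gam f -> (Lpnorm +oo f < +oo)%E ->
  exists (M : R) f', [/\ Lpnorm +oo f = M%:E, 0 <= M, cintegrable gam f',
    (\int[gam]_x (cabs (f x - f' x))%:E = 0)%E & forall x, cabs (f' x) <= M].
Proof.
move=> i fy; have m := i.1.
have N0 : (0 <= Lpnorm +oo f)%E by exact: Lnorm_ge0.
have Nf : Lpnorm +oo f \is a fin_num by rewrite ge0_fin_numE.
exists (fine (Lpnorm +oo f)); set M := fine _.
pose b x := (cabs (f x) <= M)%R.
pose k (x : X) : R := if b x then 1 else 0.
have mk : measurable_fun setT k.
  apply: measurable_fun_ifT => //.
  by apply: measurable_fun_ler => //; exact: measurable_cabs.
exists (fun x => f x * (k x)%:C)%C.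
have fM x : cabs (f x * (k x)%:C)%C <= M.
  rewrite cabsM cabs_real /k /b; case: ifPn => h; first by rewrite normr1 mulr1.
  by rewrite normr0 mulr0 fine_ge0.
have mf' : cmeas (fun x => f x * (k x)%:C)%C by apply: cmeasM => //; exact: cmeas_real.
split => //.
- by rewrite fineK.
- by rewrite fine_ge0.
- apply: (cintegrable_le mf' (measurable_cabs m) _ i.2) => x.
  rewrite cabsM cabs_real /k; case: ifPn => h; first by rewrite normr1 mulr1.
  by rewrite normr0 mulr0 cabs_ge0.
have mB := cmeasB m mf'.
rewrite (ae_eq_integral (cst 0%E))// ?integral0//; first exact: measurable_ecabs.
have := ess_sup_ge gam (fun x => (cabs (f x))%:E).
rewrite -LpnormyE; apply: filterS => x /= + _.
rewrite -(fineK Nf) lee_fin /k /b /M => ->.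
by rewrite mulr1 subrr cabs0.
Qed.

(** For the truncated functions the integrand is at most M N everywhere and mu has mass 1.
    Truncation moves neither function in L^1, so by [wickint_L1_dist] it alters [wickint] only on a
    null set. *)
Lemma wickint_Lp_infty phi psi :
  cintegrable gam phi -> cintegrable gam psi ->
  (Lpnorm +oo phi < +oo)%E -> (Lpnorm +oo psi < +oo)%E ->
  (Lpnorm +oo (wickint phi psi) <= Lpnorm +oo phi * Lpnorm +oo psi)%E.
Proof.
move=> i1 i2 /(truncation i1) [M [phi' [-> M0 i1' d1 b1]]].
move=> /(truncation i2) [N [psi' [-> N0 i2' d2 b2]]].
have mT := cmeas_wickint i1 i2; have mT' := cmeas_wickint i1' i2'.
rewrite (Lpnorm_ae mT mT' (leey _)); last first.
  apply: cabs_sub_int0_ae => //; apply/eqP; rewrite eq_le; apply/andP; split.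
    apply: (le_trans (wickint_L1_dist i1 i2 i1' i2')).
    by rewrite d1 d2 mul0e mule0 adde0.
  by apply: integral_ge0 => x _; rewrite lee_fin cabs_ge0.
rewrite LpnormyE; apply/ess_supP; apply: aeW => x.
apply: (le_trans (wickint_le _ i1'.1 i2'.1)).
have -> : (M%:E * N%:E = \int[gam]_y cst (M%:E * N%:E) y)%E.
  transitivity ((M%:E * N%:E) * gam setT)%E; first by rewrite gauss_setT mule1.
  by rewrite integral_cst.
apply: ge0_le_integral => //.
- by move=> y _; rewrite lee_fin cabs_ge0.
- by apply: measurable_ecabs; exact: (cmeas_tens_rot1 _ i1'.1 i2'.1).
- by move=> y _; rewrite /= -EFinM lee_fin cabsM ler_pM// cabs_ge0.
Qed.

Lemma wickint_Lp (p : \bar R) phi psi : (1 <= p)%E ->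
  cintegrable gam phi -> cintegrable gam psi ->
  (Lpnorm p phi < +oo)%E -> (Lpnorm p psi < +oo)%E ->
  (Lpnorm p (wickint phi psi) <= Lpnorm p phi * Lpnorm p psi)%E.
Proof.
case: p => [r||//] p1 i1 i2 l1 l2; last exact: wickint_Lp_infty.
exact: wickint_Lp_fin.
Qed.

End WickIntegral.

(** * Polynomials *)

Section Polynomials.
Variables (R : realType) (d : nat).
Local Notation X := (Rdim R d).
Local Notation gam := (@gauss_measure R d).
Implicit Types (f g h : X -> R[i]).

(** The index bounds the degree. This inductive form of [polyF] allows proofs by structural
    induction; [polyF_isPoly] and [isPoly_polyF] identify the two. *)
Inductive isPoly : nat -> (X -> R[i]) -> Prop :=
| isPoly_cst n (z : R[i]) : isPoly n (fun _ => z)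
| isPoly_mulX n i f : isPoly n f -> isPoly n.+1 (fun x => ((tnth x i : R)%:C)%C * f x)
| isPolyD n f g : isPoly n f -> isPoly n g -> isPoly n (fun x => f x + g x).

Lemma isPoly_le m n f : (m <= n)%N -> isPoly m f -> isPoly n f.
Proof.
move=> mn fm; elim: fm n mn => {m f}.
- by move=> m z n _; exact: isPoly_cst.
- by move=> m i f _ IH [//|n] mn; apply: isPoly_mulX; exact: IH.
- by move=> m f g _ IHf _ IHg n mn; apply: isPolyD; [exact: IHf|exact: IHg].
Qed.

Lemma isPolyZ n (z : R[i]) f : isPoly n f -> isPoly n (fun x => z * f x).
Proof.
elim=> {n f} [n w|n i f _ IH|n f g _ IHf _ IHg]; first exact: isPoly_cst.
  by under eq_fun do rewrite mulrCA; exact: isPoly_mulX.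
by under eq_fun do rewrite mulrDr; exact: isPolyD.
Qed.

Lemma isPolyN n f : isPoly n f -> isPoly n (fun x => - f x).
Proof. by under eq_fun do rewrite -mulN1r; exact: isPolyZ. Qed.

Lemma isPolyB n f g : isPoly n f -> isPoly n g -> isPoly n (fun x => f x - g x).
Proof. by move=> fn gn; apply: isPolyD => //; exact: isPolyN. Qed.

Lemma isPoly_sum n (I : Type) (r : seq I) (P : pred I) (F : I -> X -> R[i]) :
  (forall i, P i -> isPoly n (F i)) -> isPoly n (fun x => \sum_(i <- r | P i) F i x).
Proof.
move=> FP; elim: r => [|i r IH].
  by under eq_fun do rewrite big_nil; exact: isPoly_cst.
under eq_fun do rewrite big_cons; case Pi: (P i) => //.
by apply: isPolyD => //; exact: FP.
Qed.

Lemma isPolyM m n f g : isPoly m f -> isPoly n g -> isPoly (m + n) (fun x => f x * g x).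
Proof.
move=> + gn; elim=> {m f} [m w|m i f _ IH|m f h _ IHf _ IHh].
- by apply: isPolyZ; apply: isPoly_le gn; exact: leq_addl.
- by under eq_fun do rewrite -mulrA; exact: isPoly_mulX.
- by under eq_fun do rewrite mulrDl; exact: isPolyD.
Qed.

Lemma conjc_realM (a : R) (z : R[i]) : conjc ((a%:C)%C * z) = (a%:C)%C * conjc z.
Proof. by case: z => x y; apply: complex_ext => /=; ring. Qed.

Lemma isPolyJ n f : isPoly n f -> isPoly n (fun x => conjc (f x)).
Proof.
elim=> {n f} [n w|n i f _ IH|n f g _ IHf _ IHg]; first exact: isPoly_cst.
  rewrite (_ : (fun _ => _) = (fun x => ((tnth x i : R)%:C)%C * conjc (f x))).
    exact: isPoly_mulX.
  by apply/funext => x; rewrite conjc_realM.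
rewrite (_ : (fun _ => _) = (fun x => conjc (f x) + conjc (g x))); first exact: isPolyD.
by apply/funext => x; rewrite conjcD.
Qed.

Lemma cmeas_poly n f : isPoly n f -> cmeas f.
Proof.
elim=> {n f} [n w|n i f _ IH|n f g _ IHf _ IHg]; first exact: cmeas_cst.
  by apply: cmeasM => //; apply: cmeas_real; exact: measurable_tnth.
exact: cmeasD.
Qed.

Lemma expsumD (k l : R) (x : X) : expsum (k + l) x = expsum k x * expsum l x.
Proof. by rewrite /expsum mulrDl expRD. Qed.

Lemma expsum_ge1 (k : R) (x : X) : 0 <= k -> 1 <= expsum k x.
Proof.
move=> k0; rewrite -expR0 ler_expR mulr_ge0// sumr_ge0//.
Qed.

Lemma norm_tnth_le_expsum (x : X) i : `|tnth x i : R| <= expsum 1 x.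
Proof.
rewrite /expsum mul1r (bigD1 i)//= expRD.
have e1 (t : R) : `|t| <= expR `|t|.
  by apply: le_trans (expR_ge1Dx _); rewrite lerDr.
apply: (le_trans (e1 _)); rewrite ler_peMr ?expR_ge0// -expR0 ler_expR.
by apply: sumr_ge0 => j _; exact: normr_ge0.
Qed.

(** Each coordinate factor costs one unit of the exponent, because |t| <= e^|t|. *)
Lemma poly_expsum_bound n f : isPoly n f ->
  exists2 C : R, 0 <= C & forall x, cabs (f x) <= C * expsum n%:R x.
Proof.
elim=> {n f} [n w|n i f _ [C C0 IH]|n f g _ [C C0 IHf] _ [D D0 IHg]].
- exists (cabs w) => [|x]; first exact: cabs_ge0.
  by rewrite ler_peMr ?cabs_ge0// expsum_ge1.
- exists C => // x; rewrite cabsM cabs_real -natr1 addrC expsumD mulrCA.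
  by apply: ler_pM => //; [exact: cabs_ge0|exact: norm_tnth_le_expsum].
- exists (C + D) => [|x]; first exact: addr_ge0.
  by rewrite mulrDl (le_trans (cabsD _ _))// lerD.
Qed.

Lemma cintegrable_poly n f : isPoly n f -> cintegrable gam f.
Proof.
move=> fn; have [C C0 fC] := poly_expsum_bound fn.
have me := @measurable_expsum R d n%:R.
apply: (cintegrable_le (cmeas_poly fn) _ fC); first exact: measurable_funM.
under eq_integral do rewrite EFinM.
rewrite ge0_integralZl//; last 2 first.
- exact/measurable_EFinP.
- by move=> x _; rewrite lee_fin expsum_ge0.
by rewrite lte_mul_pinfty// expsum_int.
Qed.

Lemma isPoly_monomial (a : 'I_d -> nat) : isPoly (\sum_(i < d) a i) (@monomial R d a).
Proof.
have pw i k : isPoly k (fun x : X => ((tnth x i : R)%:C)%C ^+ k).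
  elim: k => [|k IH]; first by under eq_fun do rewrite expr0; exact: isPoly_cst.
  by under eq_fun do rewrite exprS; exact: isPoly_mulX.
rewrite /monomial; elim: (index_enum 'I_d) => [|i r IH].
  by rewrite big_nil; under eq_fun do rewrite big_nil; exact: isPoly_cst.
rewrite big_cons [X in isPoly _ X](_ : _ = fun x : X =>
    ((tnth x i : R)%:C)%C ^+ a i * \prod_(j <- r) ((tnth x j : R)%:C)%C ^+ a j).
  exact: isPolyM.
by apply/funext => x; rewrite big_cons.
Qed.

Lemma polyF_isPoly n f : @polyF R d n f -> isPoly n f.
Proof.
case=> c ->; apply: isPoly_sum => a an; apply: isPolyZ.
exact: isPoly_le an (isPoly_monomial _).
Qed.

Lemma polyF0 n : @polyF R d n (fun _ => 0).
Proof.
exists (fun _ => 0); apply/funext => x; rewrite big1// => a _.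
by rewrite mul0r.
Qed.

Lemma polyFD n f g : @polyF R d n f -> @polyF R d n g -> @polyF R d n (fun x => f x + g x).
Proof.
move=> [c ->] [c' ->]; exists (fun a => c a + c' a); apply/funext => x.
by rewrite -big_split; apply: eq_bigr => a _; rewrite mulrDl.
Qed.

Lemma polyF_sum n (I : Type) (r : seq I) (P : pred I) (F : I -> X -> R[i]) :
  (forall i, P i -> @polyF R d n (F i)) -> @polyF R d n (fun x => \sum_(i <- r | P i) F i x).
Proof.
move=> FP; elim: r => [|i r IH].
  by under eq_fun do rewrite big_nil; exact: polyF0.
under eq_fun do rewrite big_cons; case Pi: (P i) => //.
by apply: polyFD => //; exact: FP.
Qed.

Lemma polyF_monomial n (z : R[i]) (a : 'I_d -> nat) : (\sum_(i < d) a i <= n)%N ->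
  @polyF R d n (fun x => z * monomial a x).
Proof.
move=> an; have an1 i : (a i < n.+1)%N.
  by rewrite ltnS (leq_trans _ an)// (bigD1 i)//= leq_addr.
pose b : {ffun 'I_d -> 'I_n.+1} := [ffun i => Ordinal (an1 i)].
have bE : (fun i => b i : nat) = a by apply/funext => i; rewrite ffunE.
exists (fun e => if e == b then z else 0); apply/funext => x.
rewrite (bigD1 b)/=; last by under eq_bigr do rewrite ffunE.
rewrite eqxx bE big1 ?addr0// => e /andP[_ /negbTE ->].
by rewrite mul0r.
Qed.

Lemma isPoly_polyF n f : isPoly n f -> @polyF R d n f.
Proof.
elim=> {n f} [n w|n i f _ [c ->]|n f g _ IHf _ IHg]; last exact: polyFD.
  rewrite (_ : (fun _ => _) = (fun x => w * monomial (fun _ => 0%N) x)).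
    by apply: polyF_monomial; rewrite big1.
  by apply/funext => x; rewrite /monomial big1 ?mulr1// => i _; rewrite expr0.
under eq_fun do rewrite mulr_sumr.
apply: polyF_sum => a an.
pose b j := (a j + (j == i))%N.
rewrite (_ : (fun _ => _) = (fun x => c a * monomial b x)).
  apply: polyF_monomial; apply: (@leq_trans (n + 1)); last by rewrite addn1.
  rewrite big_split /= leq_add//.
  by rewrite (bigD1 i)//= eqxx big1// => j /negbTE ->.
apply/funext => x; rewrite mulrCA; congr (_ * _).
rewrite /monomial /b [RHS](eq_bigr (fun j => ((tnth x j : R)%:C)%C ^+ a j *
  ((tnth x j : R)%:C)%C ^+ (j == i))); last by move=> j _; rewrite exprD.
rewrite big_split /= mulrC; congr (_ * _).
by rewrite (bigD1 i)//= eqxx expr1 big1 ?mulr1// => j /negbTE ->; rewrite expr0.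
Qed.

(** Degree strictly below [n]. Reading degree below 0 as the zero function lets the lowest chaos
    obey the same orthogonality statements as the others. *)
Definition lowdeg n f := if n is n'.+1 then isPoly n' f else f = (fun _ => 0).

Lemma lowdeg0 n : lowdeg n (fun _ => 0).
Proof. by case: n => //= n; exact: isPoly_cst. Qed.

Lemma lowdegD n f g : lowdeg n f -> lowdeg n g -> lowdeg n (fun x => f x + g x).
Proof.
case: n => [/= -> ->|n /=]; last exact: isPolyD.
by apply/funext => x; rewrite addr0.
Qed.

Lemma lowdeg_lt i n f : (i < n)%N -> isPoly i f -> lowdeg n f.
Proof. by case: n => // n lin; exact: isPoly_le. Qed.

Lemma lowdeg_isPoly n f : lowdeg n f -> isPoly n f.
Proof. by case: n => [/= ->|n]; [exact: isPoly_cst|exact: isPoly_le]. Qed.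

(** Polynomials in two vector variables with control of the bidegree. [Q] constrains the total
    degree for orthogonality, the degree in the first variable for leading terms, or nothing when
    only integrability matters. *)
Inductive sep (Q : nat -> nat -> Prop) : (X * X -> R[i]) -> Prop :=
| sep0 : sep Q (fun _ => 0)
| sep_prod i j g h : isPoly i g -> isPoly j h -> Q i j -> sep Q (fun p => g p.1 * h p.2)
| sepD F G : sep Q F -> sep Q G -> sep Q (fun p => F p + G p).

Lemma sep_sub (Q Q' : nat -> nat -> Prop) F : (forall i j, Q i j -> Q' i j) ->
  sep Q F -> sep Q' F.
Proof.
move=> QQ'; elim=> {F} [|i j g h gi hj q|F G _ IHF _ IHG]; first exact: sep0.
  exact: sep_prod gi hj (QQ' _ _ q).
exact: sepD.
Qed.

Lemma sepM (Q1 Q2 Q : nat -> nat -> Prop) F G :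
  (forall i j i' j', Q1 i j -> Q2 i' j' -> Q (i + i')%N (j + j')%N) ->
  sep Q1 F -> sep Q2 G -> sep Q (fun p => F p * G p).
Proof.
move=> QQ sF sG; elim: sF => {F} [|i j g h gi hj q|F1 F2 _ IH1 _ IH2].
- by under eq_fun do rewrite mul0r; exact: sep0.
- elim: sG => {G} [|i' j' g' h' gi' hj' q'|G1 G2 _ IH1 _ IH2].
  + by under eq_fun do rewrite mulr0; exact: sep0.
  + under eq_fun do rewrite mulrACA.
    apply: (@sep_prod Q (i + i')%N (j + j')%N (fun x => g x * g' x) (fun x => h x * h' x)).
    * exact: isPolyM.
    * exact: isPolyM.
    * exact: QQ.
  + by under eq_fun do rewrite mulrDr; exact: sepD.
- by under eq_fun do rewrite mulrDl; exact: sepD.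
Qed.

Lemma sep_fst n f : isPoly n f -> sep (fun i j => i = n /\ j = 0%N) (fun p => f p.1).
Proof.
move=> fn; have -> : (fun p : X * X => f p.1) = (fun p => f p.1 * (fun _ => 1) p.2).
  by apply/funext => p; rewrite mulr1.
exact: (@sep_prod _ n 0 f (fun _ => 1) fn (isPoly_cst _ _)).
Qed.

Lemma sep_snd n f : isPoly n f -> sep (fun i j => i = 0%N /\ j = n) (fun p => f p.2).
Proof.
move=> fn; have -> : (fun p : X * X => f p.2) = (fun p => (fun _ => 1) p.1 * f p.2).
  by apply/funext => p; rewrite mul1r.
exact: (@sep_prod _ 0 n (fun _ => 1) f (isPoly_cst _ _) fn).
Qed.

Lemma isPoly_coord k i : isPoly k.+1 (fun x : X => ((tnth x i : R)%:C)%C).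
Proof. by under eq_fun do rewrite -[_%:C%C]mulr1; apply: isPoly_mulX; exact: isPoly_cst. Qed.

Lemma sep_coord (a b : R) (i : 'I_d) :
  sep (fun k l => (k + l)%N = 1%N)
    (fun p => ((tnth (lincomb a b p.1 p.2) i : R)%:C)%C).
Proof.
rewrite (_ : (fun _ => _) = (fun p : X * X => (a%:C)%C * ((tnth p.1 i : R)%:C)%C +
   (b%:C)%C * ((tnth p.2 i : R)%:C)%C)); last first.
  by apply/funext => p; rewrite tnth_mktuple -!rmorphM -rmorphD.
apply: sepD.
  apply: (sep_sub _ (sep_fst (isPolyZ _ (isPoly_coord 0 i)))) => k l [-> ->] //.
apply: (sep_sub _ (sep_snd (isPolyZ _ (isPoly_coord 0 i)))) => k l [-> ->] //.
Qed.

Lemma sep_lincomb n f (a b : R) : isPoly n f ->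
  sep (fun i j => (i + j <= n)%N) (fun p => f (lincomb a b p.1 p.2)).
Proof.
elim=> {n f} [n w|n i f _ IH|n f g _ IHf _ IHg]; last exact: sepD.
  by apply: (sep_sub _ (sep_fst (isPoly_cst 0 w))) => k l [-> ->].
apply: sepM (sep_coord a b i) IH => k l k' l' kl kl'.
by rewrite addnACA kl add1n ltnS.
Qed.

(** In f(a x + b y) any factor b y_i lowers the degree in x, so the part of full degree in x is a^n
    f(x). *)
Lemma sep_lincomb_lead n f (a b : R) : isPoly n f ->
  exists2 F, sep (fun i j => (i < n)%N) F &
    forall p, f (lincomb a b p.1 p.2) = ((a ^+ n)%:C)%C * f p.1 + F p.
Proof.
elim=> {n f} [n w|n i f fn [F sF fE]|n f g _ [F sF fE] _ [G sG gE]].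
(* A constant also counts as degree [n]. The error (1 - a^n) w has degree 0 in x, which is below [n]
   unless n = 0, and then it vanishes. *)
- exists (fun p => (1 - ((a ^+ n)%:C)%C) * w); last by move=> p; rewrite mulrBl mul1r addrC subrK.
  case: n => [|n].
    rewrite (_ : (fun _ => _) = fun _ => 0); first exact: sep0.
    by apply/funext => p; rewrite expr0 rmorph1 subrr mul0r.
  by apply: (sep_sub _ (sep_fst (isPoly_cst 0 _))) => k l [-> _].
(* In (a x_i + b y_i)(a^n f + F) the term a x_i a^n f is the leading one; b y_i a^n f and (a x_i + b
   y_i) F form the remainder. *)
- exists (fun p => (b%:C)%C * ((tnth p.2 i : R)%:C)%C * (((a ^+ n)%:C)%C * f p.1) +
      ((tnth (lincomb a b p.1 p.2) i : R)%:C)%C * F p).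
    apply: sepD.
      apply: (@sepM (fun k l => k = 0%N /\ l = 1%N) (fun k l => k = n /\ l = 0%N)).
      + by move=> ? ? ? ? [-> _] [-> _].
      + exact: (sep_snd (isPolyZ _ (isPoly_coord 0 i))).
      + exact: (sep_fst (isPolyZ _ fn)).
    apply: sepM (sep_coord a b i) sF => k l k' l' kl kl'.
    have k1 : (k <= 1)%N by rewrite -kl leq_addr.
    by rewrite -addnS -[n.+1]add1n leq_add.
  move=> p; rewrite fE tnth_mktuple exprSr !rmorphM !rmorphD !rmorphM /=.
  ring.
- exists (fun p => F p + G p); first exact: sepD.
  by move=> p; rewrite fE gE; ring.
Qed.

(** * Integrating sums of products: Fubini and the reflection *)

Lemma cint_gauss_cst (z : R[i]) : cint gam (fun _ => z) = z.
Proof.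
have c (r : R) : Rintegral gam setT (fun=> r) = r.
  rewrite /Rintegral integral_cst//.
  by rewrite [X in (_ * X)%E](_ : _ = 1%E) ?mule1//; exact: gauss_setT.
by apply: complex_ext; rewrite /= c.
Qed.

Lemma sep_section Q F x : sep Q F -> cintegrable gam (fun y => F (x, y)).
Proof.
elim=> {F} [|i j g h gi hj q|F G _ IHF _ IHG]; first exact: cintegrable0.
  exact: (cintegrableZ (g x) (cintegrable_poly hj)).
exact: cintegrableD.
Qed.

Lemma sep_cint n F : sep (fun i j => (i < n)%N) F ->
  lowdeg n (fun x => cint gam (fun y => F (x, y))).
Proof.
elim=> {F} [|i j g h gi hj q|F G sF IHF sG IHG].
- by under eq_fun do rewrite cint0; exact: lowdeg0.
- rewrite (_ : (fun _ => _) = fun x => cint gam h * g x); last first.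
    by apply/funext => x; rewrite [LHS](cintZ (g x) (cintegrable_poly hj)) mulrC.
  by apply: (lowdeg_lt q); exact: isPolyZ.
- under eq_fun => x do rewrite (cintD (sep_section x sF) (sep_section x sG)).
  exact: lowdegD.
Qed.

Lemma cmeas_sep Q F : sep Q F -> cmeas F.
Proof.
elim=> {F} [|i j g h gi hj q|F G _ IHF _ IHG]; first exact: cmeas_cst.
  by apply: cmeasM; [apply: (cmeas_comp _ (cmeas_poly gi))|
                     apply: (cmeas_comp _ (cmeas_poly hj))].
exact: cmeasD.
Qed.

Lemma cintegrable_sep Q F : sep Q F -> cintegrable (gam \x gam)%E F.
Proof.
elim=> {F} [|i j g h gi hj q|F G _ IHF _ IHG]; first exact: cintegrable0.
  have sF : sep Q (fun p => g p.1 * h p.2) by exact: sep_prod gi hj q.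
  have [mg ig] := cintegrable_poly gi; have [mh ih] := cintegrable_poly hj.
  split; first exact: cmeas_sep sF.
  rewrite (fubini_tonelli1 _ (measurable_ecabs (cmeas_sep sF))); last first.
    by move=> p; rewrite lee_fin cabs_ge0.
  have h0 : (0 <= \int[gam]_y (cabs (h y))%:E)%E.
    by apply: integral_ge0 => x _; rewrite lee_fin cabs_ge0.
  rewrite /fubini_F.
  under eq_integral => x _ do rewrite (ge0_integral_cabsZ gam (g x) mh).
  rewrite ge0_integralZr//; last 2 first.
  - exact: measurable_ecabs.
  - by move=> x _; rewrite lee_fin cabs_ge0.
  apply: lte_mul_pinfty => //.
    by apply: integral_ge0 => x _; rewrite lee_fin cabs_ge0.
  rewrite ge0_fin_numE//.
  by apply: integral_ge0 => x _; rewrite lee_fin cabs_ge0.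
exact: cintegrableD.
Qed.

Lemma cint_fubini (F : X * X -> R[i]) : cintegrable (gam \x gam)%E F ->
  (forall x, cintegrable gam (fun y => F (x, y))) ->
  cint gam (fun x => cint gam (fun y => F (x, y))) = cint (gam \x gam)%E F.
Proof.
move=> iF iFx; have iR := cintegrable_Re iF; have iI := cintegrable_Im iF.
apply: complex_ext; rewrite /= /Rintegral.
  rewrite -(integral12_prod_meas1 iR); congr fine; apply: eq_integral => x _.
  by rewrite fineK// (integrable_fin_num _ (cintegrable_Re (iFx x))).
rewrite -(integral12_prod_meas1 iI); congr fine; apply: eq_integral => x _.
by rewrite fineK// (integrable_fin_num _ (cintegrable_Im (iFx x))).
Qed.

Lemma cint_prot (c s : R) (F : X * X -> R[i]) : 0 < s -> c ^+ 2 + s ^+ 2 = 1 -> cmeas F ->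
  cint (gam \x gam)%E (fun p => F (prot c s p)) = cint (gam \x gam)%E F.
Proof.
move=> s0 cs mF; apply: complex_ext; rewrite /= /Rintegral; congr fine.
  apply: (gauss_rotation s0 cs (F := fun p => (complex.Re (F p))%:E)).
  apply/measurable_EFinP; exact: mF.1.
apply: (gauss_rotation s0 cs (F := fun p => (complex.Im (F p))%:E)).
apply/measurable_EFinP; exact: mF.2.
Qed.

End Polynomials.

(** * Homogeneous chaos of polynomials *)

Section PolynomialChaos.
Variables (R : realType) (d : nat).
Local Notation X := (Rdim R d).
Local Notation gam := (@gauss_measure R d).
Implicit Types (f g h : X -> R[i]).

Lemma Lpnorm0 p : p != 0%E -> Lpnorm p (fun _ : X => 0) = 0%E.
Proof.
move=> p0; rewrite /Lpnorm -(Lnorm0 gam p0); apply: eq_Lnorm => x /=.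
by rewrite cabs0.
Qed.

Lemma Lpnorm2E f : Lpnorm 2%:E f = ((\int[gam]_x (cabs (f x * (f x)^*%C))%:E) `^ 2^-1)%E.
Proof.
rewrite LpnormrE; apply: (congr1 (fun z => z `^ 2^-1)%E); apply: eq_integral => x _.
by rewrite cabsM cabsJ poweR_EFin powR_mulrn ?cabs_ge0// expr2.
Qed.

Lemma cauchy_schwarz f g : cmeas f -> cmeas g ->
  (\int[gam]_x (cabs (f x * (g x)^*%C))%:E <= Lpnorm 2%:E f * Lpnorm 2%:E g)%E.
Proof.
move=> mf mg.
have half : 2^-1 + 2^-1 = 1 :> R by field.
have := @hoelder _ X R gam (fun x => cabs (f x)) (fun x => cabs (g x)) 2 2
  (measurable_cabs mf) (measurable_cabs mg) (ltr0n _ 2) (ltr0n _ 2) half.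
rewrite Lnorm1; apply: le_trans; rewrite le_eqVlt; apply/orP; left; apply/eqP.
by apply: eq_integral => x _; rewrite cabsM cabsJ /= ger0_norm// mulr_ge0// cabs_ge0.
Qed.

Lemma cintegrable_inner f g : inLp 2%:E f -> inLp 2%:E g ->
  cintegrable gam (fun x => f x * (g x)^*%C).
Proof.
move=> [mf nf] [mg ng]; split; first by apply: cmeasM => //; exact: cmeasJ.
apply: (le_lt_trans (cauchy_schwarz mf mg)); apply: lte_mul_pinfty => //.
  exact: Lnorm_ge0.
by rewrite ge0_fin_numE//; exact: Lnorm_ge0.
Qed.

Lemma cinner_bound f g : inLp 2%:E f -> inLp 2%:E g ->
  ((cabs (cinner f g))%:E <= Lpnorm 2%:E f * Lpnorm 2%:E g)%E.
Proof.
move=> lf lg; apply: le_trans (cauchy_schwarz lf.1 lg.1).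
by apply: cabs_cint_le; exact: (cintegrable_inner lf lg).1.
Qed.

Lemma cinnerC f g : inLp 2%:E f -> inLp 2%:E g -> cinner g f = ((cinner f g)^*)%C.
Proof.
move=> lf lg; rewrite -[RHS](cintJ (cintegrable_inner lf lg)).
by congr cint; apply/funext => x; rewrite conjcMJ.
Qed.

Lemma inLp2_poly n f : isPoly n f -> inLp 2%:E f.
Proof.
move=> fn; split; first exact: cmeas_poly fn.
rewrite Lpnorm2E; apply: poweR_lty.
exact: (cintegrable_poly (isPolyM fn (isPolyJ fn))).2.
Qed.

Lemma cinner0l g : cinner (fun _ : X => 0) g = 0.
Proof.
rewrite /cinner -/(cint gam (fun x => 0 * (g x)^*%C)).
by under eq_fun do rewrite mul0r; exact: cint0.
Qed.

Lemma cinner0r f : cinner f (fun _ : X => 0) = 0.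
Proof.
rewrite /cinner -/(cint gam (fun x => f x * (0)^*%C)).
by under eq_fun do rewrite conjc0 mulr0; exact: cint0.
Qed.

Lemma inLp2D f g : inLp 2%:E f -> inLp 2%:E g -> inLp 2%:E (fun x => f x + g x).
Proof.
move=> [mf nf] [mg ng]; split; first exact: cmeasD.
have le12 : (1 <= 2%:E :> \bar R)%E by rewrite lee_fin ler1n.
have := eminkowski gam (measurable_cabs mf) (measurable_cabs mg) le12.
move=> H; apply: (@le_lt_trans _ _ (Lpnorm 2%:E f + Lpnorm 2%:E g)%E); last first.
  exact: lte_add_pinfty.
apply: le_trans H; rewrite LpnormrE unlock /Lnorm.
apply: gt0_ler_poweR; rewrite ?invr_ge0//.
- by rewrite in_itv/= leey andbT integral_ge0// => x _; first [exact: poweR_ge0|by rewrite lee_fin powR_ge0].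
- by rewrite in_itv/= leey andbT integral_ge0// => x _; first [exact: poweR_ge0|by rewrite lee_fin powR_ge0].
apply: ge0_le_integral => //.
- by move=> x _; exact: poweR_ge0.
- apply: (measurableT_comp (measurable_poweR _)); apply: measurable_ecabs.
  exact: cmeasD.
- apply: (measurableT_comp (measurable_poweR _)); apply/measurable_EFinP.
  by apply: measurableT_comp => //; apply: measurable_funD; exact: measurable_cabs.
move=> x _; rewrite lee_fin; apply: ge0_ler_powR; rewrite ?nnegrE ?cabs_ge0//.
by apply: (le_trans (cabsD _ _)); exact: ler_norm.
Qed.

Lemma inLp2Z (z : R[i]) f : inLp 2%:E f -> inLp 2%:E (fun x => z * f x).
Proof.
move=> lf; split; first by apply: cmeasM lf.1; exact: cmeas_cst.
rewrite Lpnorm2E; apply: poweR_lty.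
apply: (@le_lt_trans _ _ (\int[gam]_x (cabs ((z * z) * (f x * (f x)^*%C)))%:E)%E).
  rewrite le_eqVlt; apply/orP; left; apply/eqP; apply: eq_integral => x _.
  by rewrite !cabsM !cabsJ cabsM mulrACA.
exact: (cintegrableZ (z * z) (cintegrable_inner lf lf)).2.
Qed.

Lemma cinnerDl f g h : inLp 2%:E f -> inLp 2%:E g -> inLp 2%:E h ->
  cinner (fun x => f x + g x) h = cinner f h + cinner g h.
Proof.
move=> lf lg lh; rewrite -[RHS]cintD; try exact: cintegrable_inner.
by congr cint; apply/funext => x; rewrite mulrDl.
Qed.

Lemma cinnerZl (z : R[i]) f h : inLp 2%:E f -> inLp 2%:E h ->
  cinner (fun x => z * f x) h = z * cinner f h.
Proof.
move=> lf lh; rewrite -[RHS]cintZ; last exact: cintegrable_inner.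
by congr cint; apply/funext => x; rewrite mulrA.
Qed.

Lemma cinnerDr f g h : inLp 2%:E f -> inLp 2%:E g -> inLp 2%:E h ->
  cinner f (fun x => g x + h x) = cinner f g + cinner f h.
Proof.
move=> lf lg lh; rewrite (cinnerC _ lf); last exact: inLp2D.
by rewrite cinnerDl// conjcD -(cinnerC lg lf) -(cinnerC lh lf).
Qed.

Lemma cinnerZr (z : R[i]) f h : inLp 2%:E f -> inLp 2%:E h ->
  cinner f (fun x => z * h x) = (z^*)%C * cinner f h.
Proof.
move=> lf lh; rewrite (cinnerC _ lf); last exact: inLp2Z.
by rewrite cinnerZl// conjcM -(cinnerC lh lf).
Qed.

Lemma inLp2_sum (I : Type) (r : seq I) (P : pred I) (F : I -> X -> R[i]) :
  (forall i, P i -> inLp 2%:E (F i)) -> inLp 2%:E (fun x => \sum_(i <- r | P i) F i x).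
Proof.
move=> FP; elim: r => [|i r IH].
  by under eq_fun do rewrite big_nil; exact: inLp2_poly (isPoly_cst d 0 0).
under eq_fun do rewrite big_cons; case Pi: (P i) => //.
by apply: inLp2D => //; exact: FP.
Qed.

Lemma cinner_suml (I : Type) (r : seq I) (P : pred I) (F : I -> X -> R[i]) h :
  inLp 2%:E h -> (forall i, P i -> inLp 2%:E (F i)) ->
  cinner (fun x => \sum_(i <- r | P i) F i x) h = \sum_(i <- r | P i) cinner (F i) h.
Proof.
move=> lh FP; elim: r => [|i r IH].
  by under eq_fun do rewrite big_nil; rewrite big_nil cinner0l.
under eq_fun do rewrite big_cons; rewrite big_cons; case Pi: (P i) => //.
by rewrite cinnerDl ?IH//; [exact: FP|exact: inLp2_sum].
Qed.

Lemma cinner_sumr (I : Type) (r : seq I) (P : pred I) (F : I -> X -> R[i]) h :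
  inLp 2%:E h -> (forall i, P i -> inLp 2%:E (F i)) ->
  cinner h (fun x => \sum_(i <- r | P i) F i x) = \sum_(i <- r | P i) cinner h (F i).
Proof.
move=> lh FP; elim: r => [|i r IH].
  by under eq_fun do rewrite big_nil; rewrite big_nil cinner0r.
under eq_fun do rewrite big_cons; rewrite big_cons; case Pi: (P i) => //.
by rewrite cinnerDr ?IH//; [exact: FP|exact: inLp2_sum].
Qed.

Lemma inLp2N f : inLp 2%:E f -> inLp 2%:E (fun x => - f x).
Proof. by under eq_fun do rewrite -mulN1r; exact: inLp2Z. Qed.

Lemma cinnerNl f h : inLp 2%:E f -> inLp 2%:E h ->
  cinner (fun x => - f x) h = - cinner f h.
Proof. by move=> lf lh; rewrite -mulN1r -cinnerZl//; under eq_fun do rewrite -mulN1r. Qed.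

Lemma closure_orth (S : set (X -> R[i])) f :
  inLp 2%:E f -> (forall q, S q -> inLp 2%:E q /\ cinner f q = 0) ->
  forall h, L2closure S h -> cinner f h = 0.
Proof.
move=> lf Sq h [lh cl]; apply: cabs_eq0; apply/eqP; rewrite eq_le cabs_ge0 andbT leNgt.
apply/negP => a0; set a := cabs _ in a0.
have N0 : (0 <= Lpnorm 2%:E f)%E by exact: Lnorm_ge0.
have Nf : Lpnorm 2%:E f \is a fin_num by rewrite ge0_fin_numE// lf.2.
set b := fine (Lpnorm 2%:E f).
have b0 : 0 <= b by rewrite fine_ge0.
(* With b the norm of [f], approximating [h] within a / (b + 1) yields a <= b a / (b + 1) < a by
   Cauchy-Schwarz. The + 1 keeps the quotient meaningful when b = 0. *)
have e0 : 0 < a / (b + 1) by rewrite divr_gt0// ltr_wpDl.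
have [q [/Sq[lq fq] hq]] := cl _ e0.
have lhq : inLp 2%:E (fun x => h x - q x) by apply: inLp2D => //; exact: inLp2N.
have aE : a = cabs (cinner f (fun x => h x - q x)).
  rewrite /a; congr cabs; rewrite cinnerDr//; last exact: inLp2N.
  rewrite (_ : (fun x => - q x) = (fun x => -1 * q x)).
    by rewrite cinnerZr// fq mulr0 addr0.
  by apply/funext => x; rewrite mulN1r.
have : (a%:E <= b%:E * (a / (b + 1))%:E)%E.
  rewrite {1}aE; apply: (le_trans (cinner_bound lf lhq)).
  rewrite /b fineK//; apply: lee_pmul => //; last exact: ltW.
  exact: Lnorm_ge0.
rewrite -EFinM lee_fin mulrCA ler_pMr// ler_pdivlMr ?ltr_wpDl// mul1r.
by rewrite leNgt ltrDl ltr01.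
Qed.

(** * Polynomial chaos components and finite chaos expansions *)

Definition orthlow n f := forall h, lowdeg n h -> cinner f h = 0.

Lemma orthlow0 n : orthlow n (fun _ => 0).
Proof. by move=> h _; exact: cinner0l. Qed.

Lemma orthlowZ k n (z : R[i]) f : isPoly k f -> orthlow n f -> orthlow n (fun x => z * f x).
Proof.
move=> fk fo h hn; have hp := lowdeg_isPoly hn.
by rewrite cinnerZl ?fo ?mulr0//; [exact: inLp2_poly fk|exact: inLp2_poly hp].
Qed.

Lemma orthlow_closure k n f h : isPoly k f -> orthlow n.+1 f ->
  L2closure (@polyF R d n) h -> cinner f h = 0.
Proof.
move=> fk fo; apply: closure_orth; first exact: inLp2_poly fk.
by move=> q /polyF_isPoly qn; split; [exact: inLp2_poly qn|exact: fo].
Qed.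

Lemma L2closure_poly n f : isPoly n f -> L2closure (@polyF R d n) f.
Proof.
move=> fn; split; first exact: inLp2_poly fn.
move=> e e0; exists f; split; first exact: isPoly_polyF.
by under eq_fun do rewrite subrr; rewrite Lpnorm0 ?lte_fin// eqe pnatr_eq0.
Qed.

Lemma L2closure_le m n h : (m <= n)%N ->
  L2closure (@polyF R d m) h -> L2closure (@polyF R d n) h.
Proof.
move=> mn [lh cl]; split => // e e0; have [q [qm hq]] := cl e e0.
by exists q; split => //; apply/isPoly_polyF/(isPoly_le mn)/polyF_isPoly.
Qed.

Lemma chaos_poly n f : isPoly n f -> orthlow n f -> chaos n f.
Proof.
case: n => [|n] fn fo; first exact: L2closure_poly.
split; first exact: L2closure_poly.
by move=> h; exact: orthlow_closure fn fo.
Qed.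

Lemma chaos_closure n h : chaos n h -> L2closure (@polyF R d n) h.
Proof. by case: n => [//|n] []. Qed.

Lemma chaos_orth_lowdeg n q h : lowdeg n q -> chaos n h -> cinner q h = 0.
Proof.
move=> qn hn; have lh := (chaos_closure hn).1.
have lq := inLp2_poly (lowdeg_isPoly qn).
case: n qn hn => [/= -> _|n /= qn [_ ho]]; first exact: cinner0l.
by rewrite (cinnerC lh lq) ho ?conjc0//; exact: L2closure_poly.
Qed.

(** Whichever degree is larger provides the orthogonality: the definition of the chaos when k < n,
    and [orthlow k f], extended to closures, when n < k. *)
Lemma chaos_orth_ne k n f h : k != n -> isPoly k f -> orthlow k f -> chaos n h ->
  cinner f h = 0.
Proof.
rewrite neq_ltn => /orP[kn|nk] fk fo hn.
  by apply: chaos_orth_lowdeg hn; exact: lowdeg_lt kn fk.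
case: k nk fk fo => // k nk fk fo; apply: orthlow_closure fk fo _.
by apply: (L2closure_le _ (chaos_closure hn)); rewrite -ltnS.
Qed.

(** A finite expansion stored as an infinite sequence that vanishes from [N] on, since
    [is_chaos_dec] asks for a component in every degree. *)
Definition homog_dec N f (F : nat -> X -> R[i]) :=
  [/\ forall i, isPoly i (F i), forall i, orthlow i (F i),
      forall i, (N <= i)%N -> F i = (fun _ => 0) &
      f = fun x => \sum_(i < N) F i x].

Lemma homog_dec_chaos N f F : homog_dec N f F -> is_chaos_dec f F.
Proof.
move=> [Fp Fo F0 ->] n; split; first exact: chaos_poly.
move=> h hn; have lh := (chaos_closure hn).1.
have lF i : inLp 2%:E (F i) by exact: inLp2_poly (Fp i).
have -> : (fun x => \sum_(i < N) F i x - F n x) =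
    (fun x => \sum_(i < N | (i : nat) != n) F i x).
  apply/funext => x; have [nN|nN] := ltnP n N.
    by rewrite (bigD1 (Ordinal nN))//= addrAC subrr add0r.
  rewrite (F0 _ nN) subr0; apply: eq_bigl => i; apply/esym.
  by rewrite ltn_eqF// (leq_trans (ltn_ord i)).
by rewrite cinner_suml// big1// => i ni; exact: (chaos_orth_ne ni (Fp i) (Fo i) hn).
Qed.

Lemma homog_decZ N f F (c : R) : homog_dec N f F ->
  homog_dec N (fun x => \sum_(i < N) (c%:C)%C ^+ i * F i x)
    (fun i x => (c%:C)%C ^+ i * F i x).
Proof.
move=> [Fp Fo F0 _]; split => //.
- by move=> i; exact: isPolyZ.
- by move=> i; apply: orthlowZ; [exact: Fp|exact: Fo].
- by move=> i /F0 ->; apply/funext => x; rewrite mulr0.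
Qed.

(* One Gram-Schmidt step: if [e0] has norm zero then so has its inner product
   with anything, and the quotient below is the junk value [0]. *)
Lemma gram_schmidt n (F : nat -> X -> R[i]) m f :
  (forall k, isPoly n (F k)) -> isPoly n f ->
  exists c : nat -> R[i], forall j, (j < m)%N ->
    cinner (fun x => f x - \sum_(k < m) c k * F k x) (F j) = 0.
Proof.
move=> Fp; have lF k : inLp 2%:E (F k) by exact: inLp2_poly (Fp k).
elim: m f => [|m IH] f fp; first by exists (fun _ => 0).
have [c cP] := IH _ fp; have [c' cP'] := IH _ (Fp m).
pose w x := f x - \sum_(k < m) c k * F k x.
pose e x := F m x - \sum_(k < m) c' k * F k x.
have wp : isPoly n w.
  by apply: isPolyB => //; apply: isPoly_sum => k _; exact: isPolyZ.
have ep : isPoly n e.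
  by apply: isPolyB => //; apply: isPoly_sum => k _; exact: isPolyZ.
have lw := inLp2_poly wp; have le := inLp2_poly ep.
pose t := cinner w e / cinner e e.
have te : t * cinner e e = cinner w e.
  have [e0|] := eqVneq (cinner e e) 0; last by move=> e0; rewrite divfK.
  rewrite e0 mulr0; apply/esym/cabs_eq0/eqP; rewrite eq_le cabs_ge0 andbT -lee_fin.
  apply: (le_trans (cinner_bound lw le)).
  have -> : Lpnorm 2%:E e = 0%E; last by rewrite mule0.
  rewrite Lpnorm2E; have -> : (\int[gam]_x (cabs (e x * (e x)^*%C))%:E = 0)%E.
    have iR := cintegrable_Re (cintegrable_inner le le).
    have /= := congr1 EFin (congr1 (@complex.Re R) e0).
    rewrite /Rintegral fineK ?(integrable_fin_num _ iR)// => E0; rewrite -[RHS]/(0%:E) -E0.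
    apply: eq_integral => x _; congr EFin.
    rewrite mulrC mulJc cabs_real ger0_norm ?sqr_ge0//.
  by rewrite poweR0r// invr_eq0 pnatr_eq0.
exists (fun k => if (k == m)%N then t else c k - t * c' k).
have -> : (fun x => f x - \sum_(k < m.+1)
    (if (k : nat) == m then t else c k - t * c' k) * F k x) =
    (fun x => w x + (- t) * e x).
  apply/funext => x; rewrite big_ord_recr /= eqxx /w /e.
  have -> : \sum_(k < m) (if (k : nat) == m then t else c k - t * c' k) * F k x =
      \sum_(k < m) c k * F k x - t * \sum_(k < m) c' k * F k x.
    rewrite mulr_sumr -sumrB; apply: eq_bigr => k _.
    by rewrite ltn_eqF// mulrBl mulrA.
  by ring.
have lm : inLp 2%:E (fun x => w x + - t * e x) by apply: inLp2D => //; exact: inLp2Z.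
have wej h : inLp 2%:E h -> cinner (fun x => w x + - t * e x) h = cinner w h - t * cinner e h.
  by move=> lh; rewrite cinnerDl ?cinnerZl ?mulNr//; exact: inLp2Z.
move=> j; rewrite ltnS leq_eqVlt => /orP[/eqP ->|jm]; last first.
  by rewrite wej// cP// cP'// mulr0 subr0.
have -> : F m = (fun x => e x + \sum_(k < m) c' k * F k x).
  by apply/funext => x; rewrite /e subrK.
have lc : forall k : 'I_m, true -> inLp 2%:E (fun x => c' k * F k x) by move=> k _; exact: inLp2Z.
rewrite cinnerDr//; last exact: inLp2_sum.
rewrite wej// te subrr add0r cinner_sumr// big1// => k _.
by rewrite cinnerZr// wej// cP// cP'// mulr0 subr0 mulr0.
Qed.

(** Monomials of degree at most [n], listed in a sequence. Only their span is recorded: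
    [gram_schmidt] copes with dependent families. *)
Lemma poly_basis n : exists m (F : nat -> X -> R[i]),
  (forall k, isPoly n (F k)) /\
  forall h, isPoly n h -> exists c : nat -> R[i], h = fun x => \sum_(k < m) c k * F k x.
Proof.
pose P (a : {ffun 'I_d -> 'I_n.+1}) := (\sum_(i < d) (a i : nat) <= n)%N.
pose r := [seq a <- index_enum {ffun 'I_d -> 'I_n.+1} | P a].
(* The zero exponent as default: indices beyond the list then name the constant monomial, which
   still has degree at most [n]. *)
pose a0 : {ffun 'I_d -> 'I_n.+1} := [ffun=> ord0].
exists (size r), (fun k => @monomial R d (fun i => nth a0 r k i : nat)); split.
  move=> k; apply: isPoly_le (isPoly_monomial _ _).
  have [kr|kr] := ltnP k (size r).
    by have := mem_nth a0 kr; rewrite mem_filter => /andP[].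
  by rewrite nth_default// big1// => i _; rewrite ffunE.
move=> h /isPoly_polyF[c ->]; exists (fun k => c (nth a0 r k)).
by apply/funext => x; rewrite -big_filter (big_nth a0) big_mkord.
Qed.

(** The part split off is the orthogonal projection to a finite-dimensional space of polynomials, so
    both summands are again polynomials. *)
Lemma poly_split n f : isPoly n f -> exists g h,
  [/\ isPoly n g, orthlow n g, lowdeg n h & f = fun x => g x + h x].
Proof.
case: n => [|n] fn.
  exists f, (fun _ => 0); split => //.
    by move=> h /= ->; exact: cinner0r.
  by apply/funext => x; rewrite addr0.
have [m [F [Fp span]]] := poly_basis n.
have Fp1 k : isPoly n.+1 (F k) by exact: isPoly_le (Fp k).
have [c cP] := gram_schmidt m Fp1 fn.
have sp : isPoly n (fun x => \sum_(k < m) c k * F k x).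
  by apply: isPoly_sum => k _; exact: isPolyZ.
exists (fun x => f x - \sum_(k < m) c k * F k x), (fun x => \sum_(k < m) c k * F k x).
have gp : isPoly n.+1 (fun x => f x - \sum_(k < m) c k * F k x).
  by apply: isPolyB => //; exact: isPoly_le sp.
split => //; last by apply/funext => x; rewrite subrK.
move=> h /= /span[b ->].
have lc : forall k : 'I_m, true -> inLp 2%:E (fun x => b k * F k x).
  by move=> k _; apply: inLp2Z; exact: inLp2_poly (Fp k).
rewrite cinner_sumr//; last exact: inLp2_poly gp.
rewrite big1// => k _; rewrite cinnerZr ?cP ?mulr0//; first exact: inLp2_poly gp.
exact: inLp2_poly (Fp k).
Qed.

Lemma poly_homog_dec n f : isPoly n f -> exists F, homog_dec n.+1 f F.
Proof.
elim: n f => [|n IH] f fn; have [g [h [gp go hl ->]]] := poly_split fn.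
  exists (fun i => if i is 0%N then g else fun _ => 0); split => //.
  - by case=> // i; exact: isPoly_cst.
  - by case=> // i; exact: orthlow0.
  - by case.
  - by apply/funext => x; rewrite big_ord_recl big_ord0 hl !addr0.
have [F [Fp Fo F0 hE]] := IH h hl.
exists (fun i => if i == n.+1 then g else F i); split.
- by move=> i; case: eqP => [->|].
- by move=> i; case: eqP => [->|].
- by move=> i ni; rewrite gtn_eqF//; apply: F0; exact: ltnW.
- apply/funext => x; rewrite hE [RHS]big_ord_recr /= eqxx addrC; congr (_ + _).
  by apply: eq_bigr => i _; rewrite ltn_eqF.
Qed.

Lemma Lp_cvg_eventually p (fk : nat -> X -> R[i]) f N : p != 0%E ->
  (forall k, (N <= k)%N -> fk k = f) -> Lp_cvg p fk f.
Proof.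
move=> p0 fkf; apply: cvg_near_cst; exists N => //= k Nk; rewrite fkf//.
by under eq_fun do rewrite subrr; exact: Lpnorm0.
Qed.

Lemma sum_trim (V : nmodType) n N (A : nat -> V) : (n <= N)%N ->
  (forall i, (n <= i)%N -> A i = 0) -> \sum_(i < N) A i = \sum_(i < n) A i.
Proof.
move=> nN A0; rewrite -!(big_mkord xpredT A) (big_cat_nat (leq0n n) nN)//=.
by rewrite [X in _ + X]big_nat_cond [X in _ + X]big1 ?addr0// => i /andP[/andP[ni _] _]; exact: A0.
Qed.

Lemma is_Gamma_homog N (c : R) f F : homog_dec N f F ->
  is_Gamma c f (fun x => \sum_(i < N) (c%:C)%C ^+ i * F i x).
Proof.
move=> dF; have [Fp Fo F0 fE] := dF; split.
  by rewrite fE; apply: inLp2_sum => i _; exact: inLp2_poly (Fp i).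
split; first by apply: inLp2_sum => i _; apply: inLp2Z; exact: inLp2_poly (Fp i).
exists F; split; first exact: homog_dec_chaos dF.
apply: (@Lp_cvg_eventually _ _ _ N); first by rewrite eqe pnatr_eq0.
move=> k Nk; apply/funext => x.
by apply: (sum_trim (A := fun i => (c%:C)%C ^+ i * F i x)) => // i /F0 ->; rewrite mulr0.
Qed.

(** Once N >= m + n, the triangle i + j < N contains the m by n rectangle outside which [A]
    vanishes. *)
Lemma sum_triangle (V : nmodType) m n N (A : nat -> nat -> V) : (m + n <= N)%N ->
  (forall i j, (m <= i)%N -> A i j = 0) -> (forall i j, (n <= j)%N -> A i j = 0) ->
  \sum_(k < N) \sum_(i < k.+1) A i (k - i)%N = \sum_(i < m) \sum_(j < n) A i j.
Proof.
move=> mnN Am An.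
transitivity (\sum_(k < N) \sum_(i < N | (i <= k)%N) A i (k - i)%N).
  apply: eq_bigr => k _.
  rewrite (big_ord_widen_cond N xpredT (fun i => A i (k - i)%N))//.
rewrite (exchange_big_dep xpredT)//=.
transitivity (\sum_(i < N) \sum_(j < N - i) A i j).
  apply: eq_bigr => i _.
  rewrite -(big_mkord (fun k => (i <= k)%N) (fun k => A i (k - i)%N)).
  rewrite -(big_mkord xpredT (A i)).
  rewrite (@big_cat_nat _ _ _ i)//=; last exact: ltnW.
  rewrite big_nat_cond big1 ?add0r; last first.
    by move=> k /andP[/andP[_ ki]]; rewrite leqNgt ki.
  rewrite -{1}[i : nat]add0n big_addn big_nat_cond [RHS]big_nat_cond.
  apply: eq_big => j; last by move=> _; rewrite addnK.
  by rewrite leq_addl !andbT.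
rewrite (@sum_trim _ m N (fun i => \sum_(j < N - i) A i j)).
- apply: eq_bigr => i _; apply: sum_trim => [|j]; last exact: An.
  rewrite leq_subRL; last by rewrite (leq_trans (ltnW (ltn_ord i)))// (leq_trans _ mnN)// leq_addr.
  by apply: leq_trans mnN; rewrite leq_add2r ltnW.
- by apply: leq_trans mnN; exact: leq_addr.
- by move=> i mi; rewrite big1// => j _; exact: Am.
Qed.

End PolynomialChaos.

(** * The Wick product of polynomials *)

Section WickPolynomials.
Variables (R : realType) (d : nat) (c s : R).
Hypotheses (s0 : 0 < s) (cs : c ^+ 2 + s ^+ 2 = 1).
Local Notation X := (Rdim R d).
Local Notation gam := (@gauss_measure R d).
Local Notation wickint := (@wickint R d c s).
Implicit Types (f g h : X -> R[i]).

Lemma protK1 (p : X * X) : (prot c s (prot c s p)).1 = p.1.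
Proof.
apply: eq_from_tnth => i; rewrite /prot /= !tnth_mktuple.
transitivity (tnth p.1 i * (c ^+ 2 + s ^+ 2)); last by rewrite cs mulr1.
by ring.
Qed.

Lemma sep_tens_prot m n f g : isPoly m f -> isPoly n g ->
  sep (fun _ _ => True) (fun p => tens f g (prot c s p)).
Proof. by move=> fm gn; apply: sepM (sep_lincomb c s fm) (sep_lincomb s (- c) gn). Qed.

Lemma wickintDl f f' g m m' n : isPoly m f -> isPoly m' f' -> isPoly n g ->
  wickint (fun x => f x + f' x) g = (fun x => wickint f g x + wickint f' g x).
Proof.
move=> fm fm' gn; apply/funext => x.
have i := sep_section x (sep_tens_prot fm gn); have i' := sep_section x (sep_tens_prot fm' gn).
rewrite -[RHS](cintD i i'); congr cint; apply/funext => y.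
by rewrite /tens mulrDl.
Qed.

Lemma wickintDr f g g' m n n' : isPoly m f -> isPoly n g -> isPoly n' g' ->
  wickint f (fun x => g x + g' x) = (fun x => wickint f g x + wickint f g' x).
Proof.
move=> fm gn gn'; apply/funext => x.
have i := sep_section x (sep_tens_prot fm gn); have i' := sep_section x (sep_tens_prot fm gn').
rewrite -[RHS](cintD i i'); congr cint; apply/funext => y.
by rewrite /tens mulrDr.
Qed.

Lemma wickint0l g : wickint (fun _ => 0) g = (fun _ => 0).
Proof.
apply/funext => x; rewrite -[RHS](cint0 gam); congr cint; apply/funext => y.
by rewrite /tens mul0r.
Qed.

Lemma wickint0r f : wickint f (fun _ => 0) = (fun _ => 0).
Proof.
apply/funext => x; rewrite -[RHS](cint0 gam); congr cint; apply/funext => y.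
by rewrite /tens mulr0.
Qed.

Lemma wickint_suml N K (F : nat -> X -> R[i]) g n :
  (forall i, isPoly K (F i)) -> isPoly n g ->
  wickint (fun x => \sum_(i < N) F i x) g = (fun x => \sum_(i < N) wickint (F i) g x).
Proof.
move=> Fp gn; elim: N => [|N IH].
  rewrite (_ : (fun _ => _) = fun _ => 0) ?wickint0l; last by apply/funext => x; rewrite big_ord0.
  by apply/funext => x; rewrite big_ord0.
rewrite (_ : (fun _ => _) = fun x => (\sum_(i < N) F i x) + F N x); last first.
  by apply/funext => x; rewrite big_ord_recr.
rewrite (wickintDl (m := K) (m' := K) (n := n))//; last exact: isPoly_sum.
by apply/funext => x; rewrite IH big_ord_recr.
Qed.

Lemma wickint_sumr N K (G : nat -> X -> R[i]) f m :
  (forall i, isPoly K (G i)) -> isPoly m f ->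
  wickint f (fun x => \sum_(i < N) G i x) = (fun x => \sum_(i < N) wickint f (G i) x).
Proof.
move=> Gp fm; elim: N => [|N IH].
  rewrite (_ : (fun _ => _) = fun _ => 0) ?wickint0r; last by apply/funext => x; rewrite big_ord0.
  by apply/funext => x; rewrite big_ord0.
rewrite (_ : (fun _ => _) = fun x => (\sum_(i < N) G i x) + G N x); last first.
  by apply/funext => x; rewrite big_ord_recr.
rewrite (wickintDr (m := m) (n := K) (n' := K))//; last exact: isPoly_sum.
by apply/funext => x; rewrite IH big_ord_recr.
Qed.

(** Both factors are expanded around their leading parts in x. Every cross term falls short of
    degree m + n in x, and integrating over y leaves that degree unchanged. *)
Lemma wickint_lead m n f g : isPoly m f -> isPoly n g ->
  lowdeg (m + n)
    (fun x => wickint f g x - ((c ^+ m)%:C)%C * f x * (((s ^+ n)%:C)%C * g x)).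
Proof.
move=> fm gn.
have [F sF fE] := sep_lincomb_lead c s fm.
have [G sG gE] := sep_lincomb_lead s (- c) gn.
have pf := isPolyZ ((c ^+ m)%:C)%C fm; have pg := isPolyZ ((s ^+ n)%:C)%C gn.
(* The product of the two expansions minus the product of the leading parts, which does not depend
   on y and integrates to itself. *)
pose H (p : X * X) := ((c ^+ m)%:C)%C * f p.1 * G p +
  (F p * (((s ^+ n)%:C)%C * g p.1) + F p * G p).
have sH : sep (fun i j => (i < m + n)%N) H.
  apply: sepD; last apply: sepD.
  - by apply: sepM (sep_fst pf) sG => i j i' j' [-> _]; rewrite ltn_add2l.
  - by apply: sepM sF (sep_fst pg) => i j i' j' im [-> _]; rewrite ltn_add2r.
  - by apply: sepM sF sG => i j i' j' im i'n; rewrite -addSn leq_add// ltnW.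
rewrite (_ : (fun _ => _) = fun x => cint gam (fun y => H (x, y))); first exact: sep_cint.
apply/funext => x; apply/eqP; rewrite subr_eq addrC; apply/eqP.
rewrite -[X in _ = X + _](cint_gauss_cst d) -cintD.
- congr cint; apply/funext => y.
  have /= e1 := fE (x, y); have /= e2 := gE (x, y).
  by rewrite /tens /prot /= e1 e2 /H /=; ring.
- exact: cintegrable_poly (isPoly_cst d 0 _).
- exact: sep_section sH.
Qed.

Lemma wickint_isPoly m n f g : isPoly m f -> isPoly n g -> isPoly (m + n) (wickint f g).
Proof.
move=> fm gn; have := lowdeg_isPoly (wickint_lead fm gn).
have := isPolyM (isPolyZ ((c ^+ m)%:C)%C fm) (isPolyZ ((s ^+ n)%:C)%C gn).
move=> p1 p2; have := isPolyD p2 p1.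
by rewrite (_ : (fun _ => _) = wickint f g)//; apply/funext => x; rewrite subrK.
Qed.

(** On a product a(x) b(y) the integral is <f, a> <g, b>. A total degree below m + n forces deg a <
    m or deg b < n, so one of the two inner products vanishes. *)
Lemma cint_tens_orth m n k l N f g K : isPoly k f -> isPoly l g ->
  orthlow m f -> orthlow n g -> (N < m + n)%N -> sep (fun i j => (i + j <= N)%N) K ->
  cint (gam \x gam)%E (fun p => tens f g p * conjc (K p)) = 0.
Proof.
move=> fk gl fo go Nmn.
have sep_i K' : sep (fun i j => (i + j <= N)%N) K' ->
    cintegrable (gam \x gam)%E (fun p => tens f g p * conjc (K' p)).
  elim=> {K'} [|i j a b ai bj q|F G _ IHF _ IHG].
  - by under eq_fun do rewrite conjc0 mulr0; exact: cintegrable0.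
  - rewrite (_ : (fun _ => _) = fun p : X * X =>
      (f p.1 * conjc (a p.1)) * (g p.2 * conjc (b p.2))).
      exact: cintegrable_sep (sep_prod (Q := fun _ _ => True)
        (isPolyM fk (isPolyJ ai)) (isPolyM gl (isPolyJ bj)) I).
    by apply/funext => p; rewrite conjcM /tens mulrACA.
  - by under eq_fun do rewrite conjcD mulrDr; exact: cintegrableD.
elim=> {K} [|i j a b ai bj q|F G sF IHF sG IHG].
- by under eq_fun do rewrite conjc0 mulr0; exact: cint0.
- have ifa := cintegrable_poly (isPolyM fk (isPolyJ ai)).
  have igb := cintegrable_poly (isPolyM gl (isPolyJ bj)).
  have sp := sep_prod (Q := fun _ _ => True)
        (isPolyM fk (isPolyJ ai)) (isPolyM gl (isPolyJ bj)) I.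
  rewrite (_ : (fun _ => _) = fun p : X * X =>
      (f p.1 * conjc (a p.1)) * (g p.2 * conjc (b p.2))); last first.
    by apply/funext => p; rewrite conjcM /tens mulrACA.
  rewrite -(cint_fubini (cintegrable_sep sp)); last by move=> x; exact: sep_section sp.
  have -> : (fun x => cint gam (fun y => f x * conjc (a x) * (g y * conjc (b y)))) =
      (fun x => cinner g b * (f x * conjc (a x))).
    by apply/funext => x; rewrite (cintZ _ igb) mulrC.
  rewrite cintZ//; change (cinner g b * cinner f a = 0).
  have [im|im] := ltnP i m; first by rewrite (fo a) ?mulr0//; exact: lowdeg_lt im ai.
  have jn : (j < n)%N.
    by rewrite -(ltn_add2l i) (leq_ltn_trans q)// (leq_trans Nmn)// leq_add2r.
  by rewrite (go b) ?mul0r//; exact: lowdeg_lt jn bj.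
- under eq_fun do rewrite conjcD mulrDr.
  by rewrite cintD ?IHF ?IHG ?addr0//; exact: sep_i.
Qed.

(* The reflection [prot c s] turns the inner product of [wickint f g] with [h] into
   the one of [f (x) g] with [h (c x + s y)], a sum of products of total degree < m+n. *)
Lemma wickint_orthlow m n f g : isPoly m f -> isPoly n g -> orthlow m f -> orthlow n g ->
  orthlow (m + n) (wickint f g).
Proof.
move=> fm gn fo go h hl.
case N: (m + n)%N hl => [|N'] hl; first by rewrite hl cinner0r.
pose G (p : X * X) := tens f g p * conjc (h (lincomb c s p.1 p.2)).
have sE : sep (fun _ _ => True) (fun p => G (prot c s p)).
  rewrite (_ : (fun _ => _) = fun p => tens f g (prot c s p) * conjc (h p.1)).
    by apply: sepM (sep_tens_prot fm gn) (sep_fst (isPolyJ hl)).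
  by apply/funext => p; rewrite /G -[lincomb _ _ _ _]/(prot c s (prot c s p)).1 protK1.
transitivity (cint gam (fun x => cint gam (fun y => G (prot c s (x, y))))).
  congr cint; apply/funext => x; rewrite mulrC -cintZ.
    congr cint; apply/funext => y.
    by rewrite /G -[lincomb _ _ _ _]/(prot c s (prot c s (x, y))).1 protK1 mulrC.
  exact: sep_section (sep_tens_prot fm gn).
rewrite (cint_fubini (cintegrable_sep sE)); last by move=> x; exact: sep_section sE.
rewrite (cint_prot s0 cs).
  apply: (cint_tens_orth fm gn fo go (N := N')); first by rewrite N.
  exact: sep_lincomb.
apply: cmeasM.
  by apply: cmeas_tens; [exact: cmeas_poly fm|exact: cmeas_poly gn].
apply: cmeasJ; exact: (cmeas_comp (measurable_lincomb c s) (cmeas_poly hl)).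
Qed.

(** [wickint f g] lies in the chaos of degree m + n and differs from the scaled product by a
    polynomial of lower degree, which is orthogonal to that chaos. *)
Lemma wickint_is_proj m n f g : isPoly m f -> isPoly n g -> orthlow m f -> orthlow n g ->
  is_proj (m + n) (fun x => ((c%:C)%C ^+ m * f x) * ((s%:C)%C ^+ n * g x)) (wickint f g).
Proof.
move=> fm gn fo go; split.
  by apply: chaos_poly; [exact: wickint_isPoly|exact: wickint_orthlow].
move=> h hn; have lh := (chaos_closure hn).1.
have low := wickint_lead fm gn.
have := chaos_orth_lowdeg low hn; move=> /(congr1 -%R); rewrite oppr0 -cinnerNl//.
  move=> <-; apply: (congr1 (fun q => cinner q h)); apply/funext => x.
  by rewrite opprB !rmorphXn.
exact: inLp2_poly (lowdeg_isPoly low).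
Qed.

Lemma wick_poly m n f g : isPoly m f -> isPoly n g ->
  exists f' g', [/\ is_Gamma c f f', is_Gamma s g g' & is_wick f' g' (wickint f g)].
Proof.
move=> fm gn; have [F dF] := poly_homog_dec fm; have [G dG] := poly_homog_dec gn.
have [Fp Fo F0 fE] := dF; have [Gp Go G0 gE] := dG.
have GF := is_Gamma_homog c dF; have GG := is_Gamma_homog s dG.
have [_ [lF _]] := GF; have [_ [lG _]] := GG.
exists (fun x => \sum_(i < m.+1) (c%:C)%C ^+ i * F i x),
       (fun x => \sum_(i < n.+1) (s%:C)%C ^+ i * G i x); split; [exact: GF|exact: GG|].
split; first exact: lF.
split; first exact: lG.
split.
  exact: inLp2_poly (wickint_isPoly fm gn).
(* The powers of c and s coming from Gamma are carried by the chaos components; [wickint] is applied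
   to the unscaled [F i] and [G j] because it produces these powers itself. *)
exists (fun i x => (c%:C)%C ^+ i * F i x), (fun i x => (s%:C)%C ^+ i * G i x),
  (fun i j => wickint (F i) (G j)); split.
- exact: homog_dec_chaos (homog_decZ c dF).
- exact: homog_dec_chaos (homog_decZ s dG).
- by move=> i j; apply: wickint_is_proj.
(* The components vanish from the indices m + 1 and n + 1 on, so the double sum is constant from
   this rank on. *)
apply: (@Lp_cvg_eventually _ _ _ _ _ (m.+1 + n.+1)); first by rewrite eqe pnatr_eq0.
(* [wickint_suml] and [wickint_sumr] ask for one degree bound common to all components; those of
   index beyond the degree are zero. *)
have Fm i : isPoly m (F i).
  have [im|im] := leqP i m; first exact: isPoly_le (Fp i).
  by rewrite F0//; exact: isPoly_cst.
have Gn i : isPoly n (G i).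
  have [ni|ni] := leqP i n; first exact: isPoly_le (Gp i).
  by rewrite G0//; exact: isPoly_cst.
move=> N mnN; apply/funext => x.
rewrite (@sum_triangle _ m.+1 n.+1 N (fun i j => wickint (F i) (G j) x))//.
- rewrite fE (wickint_suml _ Fm gn) gE.
  by apply: eq_bigr => i _; rewrite (wickint_sumr _ Gn (Fm i)).
- by move=> i j /F0 ->; rewrite wickint0l.
- by move=> i j /G0 ->; rewrite wickint0r.
Qed.

End WickPolynomials.

(** * Density of polynomials in L^1 *)

Lemma cvge0_lt (R : realType) (u : nat -> \bar R) (e : R) : u @ \oo --> 0%E -> 0 < e ->
  exists N, forall n, (N <= n)%N -> (u n < e%:E)%E.
Proof.
move=> ucv e0.
by have [N _ H] := ucv _ (@nbhs_open_ereal_lt R 0 (fun _ => e) e0); exists N.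
Qed.

Section PolynomialDensity.
Variables (R : realType) (d : nat).
Local Notation X := (Rdim R d).
Local Notation gam := (@gauss_measure R d).
Implicit Types (f g : X -> R[i]) (k h : X -> R).

Definition polycl f := forall e : R, 0 < e -> exists n q, isPoly n q /\
  (\int[gam]_x (cabs (f x - q x))%:E < e%:E)%E.

Lemma polycl_poly n f : isPoly n f -> polycl f.
Proof.
move=> fn e e0; exists n, f; split => //.
by under eq_integral do rewrite subrr cabs0; rewrite integral0.
Qed.

Lemma L1_triangle f g g' : cmeas f -> cmeas g -> cmeas g' ->
  (\int[gam]_x (cabs (f x - g' x))%:E <=
   \int[gam]_x (cabs (f x - g x))%:E + \int[gam]_x (cabs (g x - g' x))%:E)%E.
Proof.
move=> mf mg mh; rewrite -ge0_integralD//.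
- apply: ge0_le_integral => //.
  + by move=> x _; rewrite lee_fin cabs_ge0.
  + by apply: measurable_ecabs; exact: cmeasB.
  + by apply: emeasurable_funD; apply: measurable_ecabs; exact: cmeasB.
  + by move=> x _; rewrite -EFinD lee_fin -(subrK (g x) (f x)) -addrA subrK; exact: cabsD.
- by move=> x _; rewrite lee_fin cabs_ge0.
- by apply: measurable_ecabs; exact: cmeasB.
- by move=> x _; rewrite lee_fin cabs_ge0.
- by apply: measurable_ecabs; exact: cmeasB.
Qed.

Lemma polycl_approx f : cmeas f ->
  (forall e : R, 0 < e -> exists g, [/\ cmeas g, polycl g &
     (\int[gam]_x (cabs (f x - g x))%:E < e%:E)%E]) -> polycl f.
Proof.
move=> mf H e e0; have e20 : 0 < e / 2 by rewrite divr_gt0.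
have [g [mg gp fg]] := H _ e20; have [n [q [qn gq]]] := gp _ e20.
exists n, q; split => //.
apply: (le_lt_trans (L1_triangle mf mg (cmeas_poly qn))).
by rewrite [e]splitr EFinD lteD.
Qed.

Lemma polyclD f g : cmeas f -> cmeas g -> polycl f -> polycl g ->
  polycl (fun x => f x + g x).
Proof.
move=> mf mg fp gp e e0; have e20 : 0 < e / 2 by rewrite divr_gt0.
have [n [q [qn fq]]] := fp _ e20; have [m [r [rm gr]]] := gp _ e20.
exists (maxn n m), (fun x => q x + r x); split.
  apply: isPolyD; first by apply: isPoly_le qn; exact: leq_maxl.
  by apply: isPoly_le rm; exact: leq_maxr.
have mq := cmeas_poly qn; have mr := cmeas_poly rm.
apply: (@le_lt_trans _ _ (\int[gam]_x (cabs (f x - q x))%:E + \int[gam]_x (cabs (g x - r x))%:E)%E).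
  rewrite -ge0_integralD//.
  - apply: ge0_le_integral => //.
    + by move=> x _; rewrite lee_fin cabs_ge0.
    + by apply: measurable_ecabs; apply: cmeasB; exact: cmeasD.
    + by apply: emeasurable_funD; apply: measurable_ecabs; exact: cmeasB.
    + by move=> x _; rewrite -EFinD lee_fin opprD addrACA; exact: cabsD.
  - by move=> x _; rewrite lee_fin cabs_ge0.
  - by apply: measurable_ecabs; exact: cmeasB.
  - by move=> x _; rewrite lee_fin cabs_ge0.
  - by apply: measurable_ecabs; exact: cmeasB.
by rewrite [e]splitr EFinD lteD.
Qed.

Lemma polycl_dominated (F : nat -> X -> R[i]) f (G : X -> R) :
  cmeas f -> (forall n, cmeas (F n)) -> (forall n, polycl (F n)) ->
  measurable_fun setT G -> (\int[gam]_x (G x)%:E < +oo)%E ->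
  (forall n x, cabs (f x - F n x) <= G x) ->
  (forall x, cabs (f x - F n x) @[n --> \oo] --> 0) -> polycl f.
Proof.
move=> mf mF Fp mG iG FG Fcv; apply: polycl_approx => // e e0.
have mD n : measurable_fun setT (fun x => (cabs (f x - F n x))%:E).
  by apply: measurable_ecabs; exact: cmeasB.
have G0 x : 0 <= G x by apply: le_trans (FG 0%N x); exact: cabs_ge0.
have [] := @dominated_convergence _ X R gam setT measurableT
  (fun n x => (cabs (f x - F n x))%:E) (cst 0%E) (EFin \o G).
- exact: mD.
- exact: measurable_cst.
- apply: aeW => x _; apply: cvg_EFin; last exact: Fcv.
  by apply: nearW.
- apply/integrableP; split; first exact/measurable_EFinP.
  by under eq_integral => x _ do rewrite gee0_abs ?lee_fin//.
- by apply: aeW => x n _; rewrite gee0_abs ?lee_fin ?cabs_ge0// FG.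
move=> _ + _; rewrite /= => cv.
have [N /(_ N (leqnn N)) /= HN] := cvge0_lt cv e0; exists (F N); split => //.
apply: le_lt_trans HN; rewrite le_eqVlt; apply/orP; left; apply/eqP.
by apply: eq_integral => x _; rewrite /= subr0 ger0_norm ?cabs_ge0.
Qed.

(* Bounded multipliers of the L^1-closure of the polynomials: unlike the closure
   itself, these obviously form an algebra. *)
Definition mult h := [/\ measurable_fun setT h, exists M, forall x, `|h x| <= M &
  forall n p, isPoly n p -> polycl (fun x => ((h x)%:C)%C * p x)].

Lemma mult_cst (a : R) : mult (fun _ => a).
Proof.
split; first exact: measurable_cst.
  by exists `|a|.
by move=> n p pn; apply: polycl_poly; exact: isPolyZ pn.
Qed.

Lemma cmeas_mult h n p : measurable_fun setT h -> isPoly n p ->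
  cmeas (fun x => ((h x)%:C)%C * p x).
Proof. by move=> mh pn; apply: cmeasM (cmeas_poly pn); exact: cmeas_real. Qed.

Lemma multD h k : mult h -> mult k -> mult (fun x => h x + k x).
Proof.
move=> [mh [M hM] hp] [mk [N kN] kp]; split; first exact: measurable_funD.
  by exists (M + N) => x; rewrite (le_trans (ler_normD _ _))// lerD.
move=> n p pn; rewrite (_ : (fun _ => _) = fun x => ((h x)%:C)%C * p x + ((k x)%:C)%C * p x).
  by apply: polyclD; [exact: cmeas_mult pn|exact: cmeas_mult pn|exact: hp pn|exact: kp pn].
by apply/funext => x; rewrite rmorphD/= mulrDl.
Qed.

(** If q approximates k p, then h q approximates h k p, since h is bounded, and h q is itself in the
    closure. This is why [mult] quantifies over all polynomials and not only p = 1. *)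
Lemma multM h k : mult h -> mult k -> mult (fun x => h x * k x).
Proof.
move=> [mh [M hM] hp] [mk [N kN] kp]; split; first exact: measurable_funM.
  by exists (M * N) => x; rewrite normrM ler_pM.
move=> n p pn; apply: polycl_approx.
  by apply: cmeas_mult pn; exact: measurable_funM.
(* The bound is read off at the origin, a point available in every dimension. *)
have M0 : 0 <= M by apply: le_trans (hM [tuple of nseq d 0]).
move=> e e0; have e1 : 0 < e / (M + 1) by rewrite divr_gt0// ltr_wpDl.
have [m [q [qm kq]]] := kp _ _ pn _ e1.
exists (fun x => ((h x)%:C)%C * q x); split; [exact: cmeas_mult qm|exact: hp qm|].
have mB : cmeas (fun x => ((k x)%:C)%C * p x - q x).
  by apply: cmeasB; [exact: cmeas_mult pn|exact: cmeas_poly qm].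
apply: (@le_lt_trans _ _ (M%:E * \int[gam]_x (cabs (((k x)%:C)%C * p x - q x))%:E)%E).
  rewrite -ge0_integralZl//.
  - apply: ge0_le_integral => //.
    + by move=> x _; rewrite lee_fin cabs_ge0.
    + apply: measurable_ecabs; apply: cmeasB; last exact: cmeas_mult qm.
      by apply: cmeas_mult pn; exact: measurable_funM.
    + by apply: emeasurable_funM => //; exact: measurable_ecabs.
    + move=> x _; rewrite -EFinM lee_fin rmorphM/= -mulrA -mulrBr cabsM cabs_real.
      by apply: ler_wpM2r => //; exact: cabs_ge0.
  - exact: measurable_ecabs.
  - by move=> x _; rewrite lee_fin cabs_ge0.
have I0 : (0 <= \int[gam]_x (cabs (((k x)%:C)%C * p x - q x))%:E)%E.
  by apply: integral_ge0 => x _; rewrite lee_fin cabs_ge0.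
move: kq I0; case: (\int[gam]_x _)%E => [r||//]; last by rewrite ltNge leey.
rewrite lte_fin lee_fin => re r0; rewrite -EFinM lte_fin.
apply: (@le_lt_trans _ _ ((M + 1) * r)); first by rewrite ler_wpM2r// lerDl.
by rewrite mulrC -ltr_pdivlMr// ltr_wpDl.
Qed.

Lemma multZ (a : R) h : mult h -> mult (fun x => a * h x).
Proof. by move=> hm; apply: multM => //; exact: mult_cst. Qed.

Lemma multB h k : mult h -> mult k -> mult (fun x => h x - k x).
Proof.
move=> hm km; rewrite (_ : (fun _ => _) = fun x => h x + (-1) * k x).
  exact: multD hm (multZ (-1) km).
by apply/funext => x; rewrite mulN1r.
Qed.

Lemma multX h n : mult h -> mult (fun x => h x ^+ n).
Proof.
move=> hm; elim: n => [|n IH]; first by under eq_fun do rewrite expr0; exact: mult_cst.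
by under eq_fun do rewrite exprS; exact: multM.
Qed.

Lemma mult_sum (I : Type) (r : seq I) (F : I -> X -> R) :
  (forall i, mult (F i)) -> mult (fun x => \sum_(i <- r) F i x).
Proof.
move=> Fm; elim: r => [|i r IH]; first by under eq_fun do rewrite big_nil; exact: mult_cst.
by under eq_fun do rewrite big_cons; exact: multD.
Qed.

Lemma mult_lim (H : nat -> X -> R) h (M : R) : (forall n, mult (H n)) ->
  (forall n x, `|H n x| <= M) -> (forall x, H n x @[n --> \oo] --> h x) -> mult h.
Proof.
move=> Hm HM Hcv.
have mh : measurable_fun setT h.
  apply: (measurable_fun_cvg (h := H)) => // n; by have [] := Hm n.
have hM x : `|h x| <= M.
  have cvn : `|H n x| @[n --> \oo] --> `|h x| by apply: cvg_norm; exact: Hcv.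
  rewrite -(cvg_lim (@Rhausdorff R) cvn); apply: limr_le; first exact: cvgP cvn.
  exact: nearW.
have M0 : 0 <= M by apply: le_trans (HM 0%N [tuple of nseq d 0]).
split => //; first by exists M.
move=> n p pn; have [mp ip] := cintegrable_poly pn.
apply: (@polycl_dominated (fun m x => ((H m x)%:C)%C * p x) _ (fun x => (M + M) * cabs (p x))).
- exact: cmeas_mult pn.
- by move=> m; apply: cmeas_mult pn; have [] := Hm m.
- by move=> m; have [_ _] := Hm m; apply; exact: pn.
- by apply: measurable_funM => //; exact: measurable_cabs.
- under eq_integral do rewrite EFinM.
  rewrite ge0_integralZl//; last 3 first.
  + exact: measurable_ecabs.
  + by move=> x _; rewrite lee_fin cabs_ge0.
  + by rewrite lee_fin addr_ge0.
  by rewrite lte_mul_pinfty// lee_fin addr_ge0.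
- move=> m x; rewrite -mulrBl cabsM -rmorphB cabs_real.
  by apply: ler_wpM2r; [exact: cabs_ge0|rewrite (le_trans (ler_normB _ _))// lerD].
- move=> x; rewrite (_ : (fun _ => _) = fun m => `|h x - H m x| * cabs (p x)).
    rewrite -(mul0r (cabs (p x))); apply: cvgM; last exact: cvg_cst.
    rewrite -(@normr0 _ R) -(subrr (h x)); apply: cvg_norm.
    by apply: cvgB => //; exact: cvg_cst.
  by apply/funext => m; rewrite -mulrBl cabsM -rmorphB cabs_real.
Qed.

(** * From the sine to indicators of half-spaces *)

Lemma norm_series_sin_le (y : R) n : `|series (sin_coeff y) n| <= expR `|y|.
Proof.
apply: (@le_trans _ _ (series (exp_coeff `|y|) n)).
  rewrite /series /=; apply: (le_trans (ler_norm_sum _ _ _)).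
  apply: ler_sum => i _; rewrite /sin_coeff /exp_coeff /= !normrM !normrX normfV.
  rewrite [`|(_`!)%:R|]ger0_norm//; apply: ler_wpM2r; first by rewrite invr_ge0.
  rewrite -[leRHS]mul1r; apply: ler_wpM2r; first exact: exprn_ge0.
  by rewrite normrN1 expr1n mulr1; case: (odd i); rewrite /= ?normr1 ?normr0.
apply: nondecreasing_cvgn_le; last exact: is_cvg_series_exp_coeff.
apply: nondecreasing_series => i _ _; exact: exp_coeff_ge0.
Qed.

(** The Taylor sums need not be bounded, so [mult_lim] is replaced by dominated convergence: they
    stay below e^|t x_i|, which is integrable against any polynomial since all exponential moments
    are finite. *)
Lemma mult_sin (t : R) (i : 'I_d) : mult (fun x : X => sin (t * tnth x i)).
Proof.
have mti : measurable_fun setT (fun x : X => t * tnth x i).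
  by apply: measurable_funM => //; exact: measurable_tnth.
have ms : measurable_fun setT (fun x : X => sin (t * tnth x i)).
  apply: (measurableT_comp (f := @sin R)) => //.
  by apply: continuous_measurable_fun; exact: continuous_sin.
split => //.
  by exists 1 => x; rewrite ler_norml sin_geN1 sin_le1.
move=> n p pn; have [C C0 pC] := poly_expsum_bound pn.
pose S m (x : X) := series (sin_coeff (t * tnth x i)) m.
have Sp m : exists N, isPoly N (fun x => ((S m x)%:C)%C).
  elim: m => [|m [N IH]].
    exists 0%N; rewrite (_ : (fun _ => _) = fun _ => 0); first exact: isPoly_cst.
    by apply/funext => x; rewrite /S /series /= big_geq.
  exists (maxn N m).
  rewrite (_ : (fun _ => _) = fun x => ((S m x)%:C)%C +
      (((odd m)%:R * (-1) ^+ m.-1./2 * t ^+ m / m`!%:R)%:C)%C * ((tnth x i : R)%:C)%C ^+ m).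
    apply: isPolyD; first by apply: isPoly_le IH; exact: leq_maxl.
    apply: isPolyZ; apply: isPoly_le (leq_maxr _ _) _.
    elim: (m) => [|l IHl]; first by under eq_fun do rewrite expr0; exact: isPoly_cst.
    by under eq_fun do rewrite exprS; exact: isPoly_mulX.
  apply/funext => x; rewrite /S /series /= big_nat_recr//= rmorphD/=; congr (_ + _).
  rewrite -rmorphXn -rmorphM; congr (_ %:C)%C.
  by rewrite /sin_coeff /= exprMn; ring.
(* The factor 2 covers the sine and its Taylor sum, each at most [expsum |t|]; C and the exponent
   [n] come from the bound on [p]. *)
pose G (x : X) := 2 * C * expsum (`|t| + n%:R) x.
have EE x : expR `|t * tnth x i| <= expsum `|t| x.
  rewrite /expsum ler_expR normrM ler_wpM2l// (bigD1 i)//= lerDl.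
  by rewrite sumr_ge0.
have mG : measurable_fun setT G.
  by apply: measurable_funM => //; exact: measurable_expsum.
have mS m : cmeas (fun x => ((S m x)%:C)%C * p x).
  by have [N SN] := Sp m; exact: cmeas_poly (isPolyM SN pn).
apply: (@polycl_dominated (fun m x => ((S m x)%:C)%C * p x) _ G).
- exact: cmeas_mult pn.
- exact: mS.
- by move=> m; have [N SN] := Sp m; exact: polycl_poly (isPolyM SN pn).
- exact: mG.
- under eq_integral do rewrite /G EFinM.
  rewrite ge0_integralZl//; last 3 first.
  + by apply/measurable_EFinP; exact: measurable_expsum.
  + by move=> x _; rewrite lee_fin expsum_ge0.
  + by rewrite lee_fin mulr_ge0.
  by rewrite lte_mul_pinfty ?lee_fin ?mulr_ge0// expsum_int// addr_ge0.
- move=> m x; rewrite -mulrBl cabsM -rmorphB cabs_real /G expsumD mulrACA [2 * _]mulrC.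
  rewrite [leRHS](_ : _ = (2 * expsum `|t| x) * (C * expsum n%:R x)); last by ring.
  apply: ler_pM => //; first exact: cabs_ge0.
  rewrite mulr2n mulrDl mul1r (le_trans (ler_normB _ _))// lerD//.
    apply: (@le_trans _ _ 1); last by rewrite expsum_ge1.
    by rewrite ler_norml sin_geN1 sin_le1.
  exact: le_trans (norm_series_sin_le _ _) (EE x).
- move=> x.
  rewrite (_ : (fun _ => _) = fun m => `|sin (t * tnth x i) - S m x| * cabs (p x)).
    rewrite -(mul0r (cabs (p x))); apply: cvgM; last exact: cvg_cst.
    rewrite -(@normr0 _ R) -(subrr (sin (t * tnth x i))); apply: cvg_norm.
    apply: cvgB; first exact: cvg_cst.
    by rewrite /S sin.unlock; exact: is_cvg_series_sin_coeff.
  by apply/funext => m; rewrite -mulrBl cabsM -rmorphB cabs_real.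
Qed.

(* Each stage is a polynomial in [y], and the iteration increases to [sqrt y] on [0, 1]. *)
Fixpoint sqrt_iter (y : R) n : R :=
  if n is n'.+1 then sqrt_iter y n' + (y - sqrt_iter y n' ^+ 2) / 2 else 0.

Lemma sqrt_iter_bounds (r : R) n : 0 <= r <= 1 ->
  [/\ 0 <= sqrt_iter (r ^+ 2) n, sqrt_iter (r ^+ 2) n <= r &
      r - sqrt_iter (r ^+ 2) n <= r * (1 - r / 2) ^+ n].
Proof.
move=> /andP[r0 r1]; elim: n => [|n [p0 pr IH]] /=; first by rewrite expr0 mulr1 subr0.
set p := sqrt_iter _ n in p0 pr IH *.
(* The error is multiplied by 1 - (r + p) / 2, which lies between 0 and 1 - r / 2 because 0 <= p <=
   r <= 1. *)
have E : r - (p + (r ^+ 2 - p ^+ 2) / 2) = (r - p) * (1 - (r + p) / 2) by field.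
have rp : 0 <= r - p by rewrite subr_ge0.
split.
- by rewrite addr_ge0// divr_ge0// subr_ge0 lerXn2r.
- by rewrite -subr_ge0 E mulr_ge0//; lra.
- rewrite E exprSr mulrA; apply: ler_pM => //; lra.
Qed.

Lemma cvg_sqrt_iter (r : R) : 0 <= r <= 1 ->
  sqrt_iter (r ^+ 2) n @[n --> \oo] --> r.
Proof.
move=> r01; have /andP[r0 r1] := r01.
apply: (@squeeze_cvgr _ _ _ _ (fun n => r - r * (1 - r / 2) ^+ n) (fun _ => r)).
- apply: nearW => n; have [_ pr H] := sqrt_iter_bounds n r01.
  by rewrite pr andbT; move: H; lra.
- rewrite -[X in _ --> X]subr0; apply: cvgB; first exact: cvg_cst.
  (* At r = 0 the ratio is 1 and nothing decays, but the prefactor r is then zero. *)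
  have [->|rn0] := eqVneq r 0.
    by under eq_fun do rewrite mul0r; exact: cvg_cst.
  apply: cvg_geometric; have rp : 0 < r by rewrite lt_neqAle eq_sym rn0.
  by rewrite ger0_norm; lra.
- exact: cvg_cst.
Qed.

(** |h| is N times the square root of (h / N)^2, where N = M + 1 is positive and brings |h| / N into
    [0, 1]. The iterates are polynomials in h^2. *)
Lemma mult_norm h : mult h -> mult (fun x => `|h x|).
Proof.
move=> hm; have [_ [M hM] _] := hm.
pose N := M + 1.
have N0 : 0 < N by rewrite /N ltr_wpDl// (le_trans _ (hM [tuple of nseq d 0])).
pose r (x : X) := `|h x| / N.
have r01 x : 0 <= r x <= 1.
  rewrite divr_ge0 ?(ltW N0)//= ler_pdivrMr// mul1r (le_trans (hM x))//.
  by rewrite /N lerDl.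
rewrite (_ : (fun _ => _) = fun x => N * r x); last first.
  by apply/funext => x; rewrite /r mulrC divfK ?gt_eqF.
apply: multZ; apply: (@mult_lim (fun n x => sqrt_iter (r x ^+ 2) n) _ 1).
- elim=> [|n IH] /=; first exact: mult_cst.
  apply: (multD IH).
  have -> : (fun x => (r x ^+ 2 - sqrt_iter (r x ^+ 2) n ^+ 2) / 2) =
      (fun x => 2^-1 * (r x ^+ 2 - sqrt_iter (r x ^+ 2) n ^+ 2)).
    by apply/funext => x; rewrite mulrC.
  apply: multZ; apply: multB; last exact: multX.
  rewrite (_ : (fun _ => _) = fun x => (N ^-1 ^+ 2) * (h x) ^+ 2).
    by apply: multZ; exact: multX.
  by apply/funext => x; rewrite /r exprMn real_normK ?num_real// mulrC.
- move=> n x; have [p0 pr _] := sqrt_iter_bounds n (r01 x).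
  by rewrite ger0_norm// (le_trans pr)//; have /andP[] := r01 x.
- by move=> x; exact: cvg_sqrt_iter.
Qed.

(** With z = 1 - h^+ / N, where h^+ = (h + |h|) / 2, one has 0 <= z <= 1, and z < 1 exactly where h
    > 0. Hence 1 - z^n tends to the indicator. *)
Lemma mult_pos_indic h : mult h -> mult (\1_[set x | 0 < h x]).
Proof.
move=> hm; have [_ [M hM] _] := hm.
pose N := M + 1.
have N0 : 0 < N by rewrite /N ltr_wpDl// (le_trans _ (hM [tuple of nseq d 0])).
pose z (x : X) := 1 - (h x + `|h x|) / 2 / N.
have zm : mult z.
  apply: multB; first exact: mult_cst.
  under eq_fun do rewrite mulrC; apply: multZ; under eq_fun do rewrite mulrC; apply: multZ.
  by apply: multD => //; exact: mult_norm.
have z01 x : 0 <= z x <= 1.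
  have /andP[h1 h2] : - N <= h x <= N.
    by rewrite -ler_norml (le_trans (hM x))// /N lerDl.
  rewrite /z; case: (ger0P (h x)) => hx.
    rewrite subr_ge0 ler_pdivrMr// mul1r lerBlDr lerDl divr_ge0 ?(ltW N0)// ?divr_ge0 ?addr_ge0//.
    by rewrite andbT; lra.
  by rewrite subrr !mul0r subr0 ler01 lexx.
apply: (@mult_lim (fun n x => 1 - z x ^+ n) _ 1).
- by move=> n; apply: multB; [exact: mult_cst|exact: multX].
- move=> n x; have /andP[z0 z1] := z01 x.
  rewrite ger0_norm ?subr_ge0 ?exprn_ile1// lerBlDr lerDl exprn_ge0//.
- move=> x; rewrite indicE; have /andP[z0 z1] := z01 x.
  case: (ltP 0 (h x)) => hx.
    rewrite mem_set//= -[X in _ --> X]subr0; apply: cvgB; first exact: cvg_cst.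
    apply: cvg_expr; rewrite ger0_norm// /z gtr0_norm// ltrBlDr ltrDl.
    by rewrite !divr_gt0// addr_gt0.
  rewrite memNset /=; last by rewrite /= ltNge hx.
  rewrite /z ler0_norm// subrr !mul0r subr0.
  by under eq_fun do rewrite expr1n subrr; exact: cvg_cst.
Qed.

(** The sine is increasing on [-pi/2, pi/2]. Dividing x_i and a by n + 1 brings both into this
    interval for large n, and comparing the sines then compares x_i with a. *)
Lemma mult_ray (a : R) (i : 'I_d) : mult (\1_[set x : X | a < tnth x i]).
Proof.
pose A n : set X := [set x | 0 < sin (n.+1%:R^-1 * tnth x i) - sin (n.+1%:R^-1 * a)].
apply: (@mult_lim (fun n => \1_(A n)) _ 1).
- move=> n; apply: (mult_pos_indic (h := fun x => sin (n.+1%:R^-1 * tnth x i) - _)).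
  by apply: multB; [exact: mult_sin|exact: mult_cst].
- by move=> n x; rewrite indicE; case: (_ \in _); rewrite ?normr1 ?normr0.
move=> x; apply: cvg_near_cst.
have [N aN] : exists N : nat, `|tnth x i : R| + `|a| <= N%:R.
  exists (Num.truncn (`|tnth x i : R| + `|a|)).+1.
  by rewrite ltW// truncnS_gt.
exists N => //= n Nn; rewrite !indicE; congr (_%:R); congr (nat_of_bool _).
have small (b : R) : `|b| <= `|tnth x i : R| + `|a| -> n.+1%:R^-1 * b \in `[(- (pi / 2)), pi / 2].
  move=> bb; rewrite in_itv/= -ler_norml normrM.
  apply: le_trans (pihalf_ge1 R).
  rewrite ger0_norm ?invr_ge0// mulrC ler_pdivrMr// mul1r.
  by apply: (le_trans bb); apply: (le_trans aN); rewrite ler_nat ltnW.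
apply/idP/idP; rewrite !inE /A /= subr_gt0 ltr_sin ?small ?lerDl ?lerDr//.
  by rewrite ltr_pM2l ?invr_gt0.
by rewrite ltr_pM2l ?invr_gt0.
Qed.

(** * The sigma-algebra of sets with multiplier indicators *)

Definition mult_set (A : set X) := mult (\1_A).

Lemma mult_setC A : mult_set A -> mult_set (~` A).
Proof.
move=> Am; rewrite /mult_set (_ : \1_(~` A) = fun x => 1 - \1_A x).
  by apply: multB => //; exact: mult_cst.
by apply/funext => x; rewrite !indicE in_setC; case: (x \in A); rewrite /= ?subrr ?subr0.
Qed.

(** The indicator of the union is the limit of 1 - prod_(k < n) (1 - 1_(F k)). Stability under
    products handles overlapping sets, so a sigma-algebra is obtained directly. *)
Lemma mult_set_bigcup (F : nat -> set X) : (forall n, mult_set (F n)) ->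
  mult_set (\bigcup_n F n).
Proof.
move=> Fm; pose H n (x : X) : R := \prod_(k < n) (1 - \1_(F k) x).
have H01 n x : H n x = 0 \/ H n x = 1.
  rewrite /H; elim: n => [|n IH]; first by right; rewrite big_ord0.
  rewrite big_ord_recr /= indicE; case: (x \in F n); rewrite ?subrr ?mulr0 ?subr0 ?mulr1//.
  by left.
apply: (@mult_lim (fun n x => 1 - H n x) _ 1).
- move=> n; apply: multB; first exact: mult_cst.
  elim: n => [|n IH]; first by rewrite /H; under eq_fun do rewrite big_ord0; exact: mult_cst.
  rewrite /H; under eq_fun do rewrite big_ord_recr /=.
  by apply: multM => //; apply: multB; [exact: mult_cst|exact: Fm].
- by move=> n x; case: (H01 n x) => ->; rewrite ?subr0 ?subrr ?normr1 ?normr0.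
move=> x; apply: cvg_near_cst; rewrite indicE.
have [[k _ Fkx]|nF] := pselect ((\bigcup_n F n) x).
  exists k.+1 => //= n kn; rewrite mem_set; last by exists k.
  rewrite /H (bigD1 (Ordinal kn))//= indicE mem_set//.
  by rewrite subrr mul0r subr0.
exists 0%N => //= n _; rewrite memNset// /H big1 ?subrr// => k _.
by rewrite indicE memNset ?subr0// => Fk; apply: nF; exists k.
Qed.

Lemma mult_set_sigma : sigma_algebra setT mult_set.
Proof.
split; last exact: mult_set_bigcup.
  by rewrite /mult_set indic0; exact: mult_cst.
by move=> A Am; rewrite setTD; exact: mult_setC.
Qed.

(** The sets B whose preimage is a multiplier set form a sigma-algebra, and it contains the rays
    that generate the Borel sets. *)
Lemma mult_set_coord (i : 'I_d) (B : set (measurableTypeR R)) : measurable B ->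
  mult_set (@tnth d _ ^~ i @^-1` B).
Proof.
have sB : sigma_algebra setT (image_set_system setT (fun x : X => tnth x i) mult_set).
  by apply: sigma_algebra_image; exact: mult_set_sigma.
have : measurable `<=` image_set_system setT (fun x : X => tnth x i) mult_set.
  have mE : (measurable : set (set (measurableTypeR R))) = (@RGenOInfty.G R).-sigma.-measurable.
    exact: RGenOInfty.measurableE.
  rewrite mE; apply: smallest_sub => //.
  move=> _ [a ->]; rewrite /image_set_system /= setTI.
  rewrite (_ : _ @^-1` _ = [set x : X | a < tnth x i]); first exact: mult_ray.
  by apply/seteqP; split => x /=; rewrite in_itv/= andbT.
by move=> sub mB; have := sub _ mB; rewrite /image_set_system /= setTI.
Qed.

Lemma measurable_mult_set (A : set X) : measurable A -> mult_set A.
Proof.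
move: A; apply: smallest_sub; first exact: mult_set_sigma.
rewrite -bigcup_seq => A [i _ [B mB <-]]; rewrite setTI.
exact: mult_set_coord.
Qed.

Import HBSimple.

Lemma real_polycl h : gam.-integrable setT (EFin \o h) -> polycl (fun x => ((h x)%:C)%C).
Proof.
move=> ih; have mh : measurable_fun setT h.
  by apply/measurable_EFinP; exact: measurable_int ih.
apply: polycl_approx; first exact: cmeas_real.
move=> e e0; have [g_ [ig _ cg]] := approximation_sfun_integrable measurableT ih.
have [N /(_ N (leqnn N)) /= HN] := cvge0_lt cg e0.
have gm : mult (g_ N).
  rewrite (funext (fimfunEord (g_ N))); apply: mult_sum => j; apply: multZ.
  by apply: measurable_mult_set; exact: measurable_funPTI.
exists (fun x => ((g_ N x)%:C)%C); split.
- by apply: cmeas_real; case: gm.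
- have [_ _ H] := gm; have := H _ _ (isPoly_cst d 0 1).
  by under eq_fun do rewrite mulr1.
- apply: le_lt_trans HN; rewrite le_eqVlt; apply/orP; left; apply/eqP.
  by apply: eq_integral => x _; rewrite -rmorphB cabs_real.
Qed.

Lemma polynomials_dense f : cintegrable gam f -> polycl f.
Proof.
move=> fi; have [mf _] := fi.
have iR := real_polycl (cintegrable_Re fi); have iI := real_polycl (cintegrable_Im fi).
rewrite (_ : f = fun x => ((complex.Re (f x))%:C)%C + 'i%C * ((complex.Im (f x))%:C)%C).
  apply: polyclD => //.
  - by apply: cmeas_real; exact: mf.1.
  - by apply: cmeasM; [exact: cmeas_cst|apply: cmeas_real; exact: mf.2].
  move=> e e0; have [n [q [qn fq]]] := iI e e0; exists n, (fun x => 'i%C * q x).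
  split; first exact: isPolyZ.
  apply: le_lt_trans fq; rewrite le_eqVlt; apply/orP; left; apply/eqP.
  apply: eq_integral => x _; rewrite -mulrBr cabsM; congr EFin.
  by rewrite /cabs /= expr0n expr1n add0r sqrtr1 mul1r.
by apply/funext => x; rewrite -complexE.
Qed.

End PolynomialDensity.

(** * Extension to L^1 *)

Section Extension.
Variables (R : realType) (d : nat).
Local Notation X := (Rdim R d).
Local Notation gam := (@gauss_measure R d).
Implicit Types (f g phi psi w : X -> R[i]).

Lemma cintegrable_norm_fin f : cintegrable gam f ->
  exists2 A : R, 0 <= A & (\int[gam]_x (cabs (f x))%:E = A%:E)%E.
Proof.
move=> [_ fi].
have I0 : (0 <= \int[gam]_x (cabs (f x))%:E)%E.
  by apply: integral_ge0 => x _; rewrite lee_fin cabs_ge0.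
exists (fine (\int[gam]_x (cabs (f x))%:E)%E); first exact: fine_ge0.
by rewrite fineK// ge0_fin_numE.
Qed.

Lemma poly_sequence f : cintegrable gam f -> exists q : nat -> X -> R[i],
  forall k, (exists n, isPoly n (q k)) /\
    (\int[gam]_x (cabs (f x - q k x))%:E <= (k.+1%:R^-1)%:E)%E.
Proof.
move=> fi.
suff /choice[q qP] : forall k, exists q, (exists n, isPoly n q) /\
    (\int[gam]_x (cabs (f x - q x))%:E <= (k.+1%:R^-1)%:E)%E by exists q.
move=> k; have k0 : 0 < k.+1%:R^-1 :> R by rewrite invr_gt0.
have [n [q [qn fq]]] := polynomials_dense fi k0.
by exists q; split; [exists n|exact: ltW].
Qed.

Lemma poly_sequence_cvg f (q : nat -> X -> R[i]) :
  (forall k, (\int[gam]_x (cabs (f x - q k x))%:E <= (k.+1%:R^-1)%:E)%E) ->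
  Lp_cvg 1%:E q f.
Proof.
move=> fq; rewrite /Lp_cvg.
apply: (@squeeze_cvge _ _ _ _ (fun _ => 0%E) _ (fun k => (k.+1%:R^-1)%:E)).
- apply: nearW => k; rewrite Lpnorm1E; apply/andP; split.
    by apply: integral_ge0 => x _; rewrite lee_fin cabs_ge0.
  apply: le_trans (fq k); rewrite le_eqVlt; apply/orP; left; apply/eqP.
  by apply: eq_integral => x _; rewrite cabsB.
- exact: cvg_cst.
- exact: cvge_harmonic.
Qed.

(** The two terms of [wickint_L1_dist] are at most B / (k + 1) and (1 + A) / (k + 1): an approximant
    of [phi] within 1 / (k + 1) <= 1 has norm at most 1 + A. *)
Lemma wickint_poly_rate (c s : R) phi psi : 0 < s -> c ^+ 2 + s ^+ 2 = 1 ->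
  cintegrable gam phi -> cintegrable gam psi ->
  exists C : R, forall (k : nat) m n q r, isPoly m q -> isPoly n r ->
    (\int[gam]_x (cabs (phi x - q x))%:E <= (k.+1%:R^-1)%:E)%E ->
    (\int[gam]_x (cabs (psi x - r x))%:E <= (k.+1%:R^-1)%:E)%E ->
    (\int[gam]_x (cabs (wickint c s phi psi x - wickint c s q r x))%:E
      <= (C / k.+1%:R)%:E)%E.
Proof.
move=> s0 cs i1 i2.
have [A A0 EA] := cintegrable_norm_fin i1; have [B B0 EB] := cintegrable_norm_fin i2.
exists (B + (1 + A)) => k m n q r qm rn hq hr.
have iq := cintegrable_poly qm; have ir := cintegrable_poly rn.
apply: (le_trans (wickint_L1_dist s0 cs i1 i2 iq ir)).
have Iq : (\int[gam]_x (cabs (q x))%:E <= (1 + A)%:E)%E.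
  have := L1_triangle iq.1 i1.1 (cmeas_cst X 0).
  under eq_integral do rewrite subr0.
  under [X in (_ <= _ + X)%E -> _]eq_integral do rewrite subr0.
  rewrite EA => H; apply: (le_trans H); rewrite EFinD leeD2r//.
  under eq_integral do rewrite cabsB.
  by apply: (le_trans hq); rewrite lee_fin invf_le1// ler1n.
rewrite EB mulrDl EFinD; apply: leeD.
  by rewrite [(B / _)%R]mulrC EFinM; apply: lee_wpmul2r => //; rewrite lee_fin.
rewrite EFinM; apply: lee_pmul => //.
- by apply: integral_ge0 => x _; rewrite lee_fin cabs_ge0.
- by apply: integral_ge0 => x _; rewrite lee_fin cabs_ge0.
Qed.

(** Along polynomial approximations the values of [wickint] are legitimate L^2 values, so they
    converge to [w] by [wickGamma]; by the L^1 estimate they also converge to [wickint] of the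
    limits. *)
Lemma wickGamma_wickint (u v : R) phi psi w : 0 < u -> 0 < v -> u^-1 + v^-1 = 1 ->
  wickGamma u v phi psi w ->
  {ae gam, forall x, w x = wickint (Num.sqrt u)^-1 (Num.sqrt v)^-1 phi psi x}.
Proof.
move=> u0 v0 uv [/inLp1P i1 /inLp1P i2 /inLp1P iw H].
set c := (Num.sqrt u)^-1; set s := (Num.sqrt v)^-1.
have c0 : 0 < c by rewrite invr_gt0 sqrtr_gt0.
have s0 : 0 < s by rewrite invr_gt0 sqrtr_gt0.
have cs : c ^+ 2 + s ^+ 2 = 1 by rewrite !exprVn !sqr_sqrtr ?ltW.
have [q qP] := poly_sequence i1; have [r rP] := poly_sequence i2.
have wcv : Lp_cvg 1%:E (fun k => wickint c s (q k) (r k)) w.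
  apply: (H q r).
  - move=> k; have [[m qm] _] := qP k; have [[n rn] _] := rP k.
    split; [exact: inLp2_poly qm|exact: inLp2_poly rn|].
    exact: (wick_poly s0 cs qm rn).
  - by apply: poly_sequence_cvg => k; have [] := qP k.
  - by apply: poly_sequence_cvg => k; have [] := rP k.
have iT := cintegrable_wickint s0 cs i1 i2.
have [C CP] := wickint_poly_rate s0 cs i1 i2.
apply: cabs_sub_int0_ae; [exact: iw.1|exact: iT.1|].
have I0 : (0 <= \int[gam]_x (cabs (w x - wickint c s phi psi x))%:E)%E.
  by apply: integral_ge0 => x _; rewrite lee_fin cabs_ge0.
apply/eqP; rewrite eq_le I0 andbT; apply/lee_addgt0Pr => e e0; rewrite add0e.
have e20 : 0 < e / 2 by rewrite divr_gt0.
have [N HN] := cvge0_lt wcv e20.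
(* k >= N controls the distance to [w]; k + 1 > C / (e / 2) makes C / (k + 1) at most e / 2. *)
pose k := maxn N (Num.truncn (C / (e / 2))).
have [[m qm] qk] := qP k; have [[n rn] rk] := rP k.
have iqr := cintegrable_wickint s0 cs (cintegrable_poly qm) (cintegrable_poly rn).
apply: (le_trans (L1_triangle iw.1 iqr.1 iT.1)).
rewrite [e]splitr EFinD; apply: leeD.
  under eq_integral do rewrite cabsB.
  by have := HN k (leq_maxl _ _); rewrite Lpnorm1E => /ltW.
under eq_integral do rewrite cabsB.
apply: (le_trans (CP k _ _ _ _ qm rn qk rk)); rewrite lee_fin.
rewrite ler_pdivrMr// mulrC -ler_pdivrMr//.
have : C / (e / 2) < (Num.truncn (C / (e / 2))).+1%:R by exact: truncnS_gt.
move/ltW/le_trans; apply.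
by rewrite ler_nat ltnS leq_maxr.
Qed.

End Extension.

Theorem theorem4p1 (R : realType) (d : nat) (p : \bar R) (u v : R)
    (phi psi w : Rdim R d -> R[i]) :
  (1 <= p)%E -> 0 < u -> 0 < v -> u^-1 + v^-1 = 1 ->
  inLp p phi -> inLp p psi ->
  wickGamma u v phi psi w ->
  inLp p w /\ (Lpnorm p w <= Lpnorm p phi * Lpnorm p psi)%E.
Proof.
move=> p1 u0 v0 uv [mphi lphi] [mpsi lpsi] W.
have wT := wickGamma_wickint u0 v0 uv W.
have [/inLp1P i1 /inLp1P i2 /inLp1P iw _] := W.
have s0 : 0 < (Num.sqrt v)^-1 by rewrite invr_gt0 sqrtr_gt0.
have cs : (Num.sqrt u)^-1 ^+ 2 + (Num.sqrt v)^-1 ^+ 2 = 1.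
  by rewrite !exprVn !sqr_sqrtr ?ltW.
have le : (Lpnorm p w <= Lpnorm p phi * Lpnorm p psi)%E.
  rewrite (Lpnorm_ae iw.1 (cmeas_wickint s0 cs i1 i2) p1 wT).
  exact: wickint_Lp.
split => //; split; first exact: iw.1.
apply: (le_lt_trans le); apply: lte_mul_pinfty => //; first exact: Lnorm_ge0.
by rewrite ge0_fin_numE//; exact: Lnorm_ge0.
Qed.
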